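(* Let $G=\langle a,b\rangle\le \mathrm{Aut}(T)$ be the group generated by the recursively defined automorphisms $a=(1,b)$, $b=(1,a)\varepsilon$ of the rooted binary tree $T$. Then $G$ is amenable, and $\mathsf{SG}\neq\mathsf{AG}$.
   Context: $T$ is the rooted binary tree with vertex set $V$ consisting of all finite binary sequences and edge set $\{(v,vi): v\in V,\ i\in\{0,1\}\}$. Automorphisms act on the right, written $g: v\mapsto v^g$, so $v^{gh}=(v^g)^h$. For $g,h\in\mathrm{Aut}(T)$, $(g,h)$ denotes the automorphism sending $0v\mapsto 0v^g$ and $1v\mapsto 1v^h$. The automorphism $\varepsilon$ sends $iv$ to $((i+1)\bmod 2)v$ for $i\in\{0,1\}$. The elements $a,b$ are the unique automorphisms satisfying $a=(1,b)$ and $b=(1,a)\varepsilon$. A (discrete) group is amenable if it admits a finitely additive invariant probability measure; $\mathsf{AG}$ is the class of amenable groups. $\mathsf{SG}$ (subexponentially amenable groups) is the smallest class of groups that contains all groups of subexponential growth and is closed under taking subgroups, quotients, extensions and direct limits. One has $\mathsf{SG}\subseteq\mathsf{AG}$. *)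

(* Defs.v *)
From HB Require Import structures.
From mathcomp Require Import all_boot all_order all_algebra finmap.
From mathcomp Require Import all_classical all_reals all_analysis.
Import numFieldNormedType.Exports.

Set Implicit Arguments.
Unset Strict Implicit.
Unset Printing Implicit Defensive.

Import Order.TTheory GRing.Theory Num.Theory.
Local Open Scope classical_set_scope.
Local Open Scope group_scope.

(* Discrete groups are objects of the library's [groupType]; they may be
   infinite. *)

Definition is_subgroup (G : groupType) (H : set G) : Prop :=
  [/\ H 1, forall x y, H x -> H y -> H (x * y) & forall x, H x -> H x^-1].

Definition gen_set (G : groupType) (A : set G) : set G :=
  smallest (@is_subgroup G) A.

Lemma gen_set_subgroup (G : groupType) (A : set G) : is_subgroup (gen_set A).
Proof.
split=> [H [[H1 _ _] _]|x y Hx Hy H HA|x Hx H HA] //.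
- by case: (HA) => -[_ HM _] _; apply: HM; [exact: Hx|exact: Hy].
- by case: (HA) => -[_ _ HV] _; apply: HV; exact: Hx.
Qed.

(* The subgroup generated by A, as a group in its own right. *)
Record gen_group (G : groupType) (A : set G) := GenGroup {
  gen_val :> G;
  gen_valP : `[< gen_set A gen_val >]
}.

HB.instance Definition _ (G : groupType) (A : set G) :=
  [isSub for @gen_val G A].
HB.instance Definition _ (G : groupType) (A : set G) :=
  [Choice of gen_group A by <:].

Fact gen_group_closed (G : groupType) (A : set G) :
  group_closed [pred x : G | `[< gen_set A x >]].
Proof.
have [H1 HM HV] := gen_set_subgroup A.
split=> [|x y /asboolP Hx /asboolP Hy]; first by apply/asboolP; exact: H1.
by apply/asboolP; apply: HM => //; exact: HV.
Qed.

HB.instance Definition _ (G : groupType) (A : set G) :=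
  SubChoice_isSubGroup.Build G _ (gen_group A) (gen_group_closed A).

(* On a group, invariance under left translations and under right translations
   lead to the same class of groups (push the measure forward by x |-> x^-1). *)
Definition amenable (R : realType) (G : groupType) : Prop :=
  exists mu : set G -> R,
    [/\ forall A, (0 <= mu A)%R,
        mu setT = 1%R,
        forall A B, A `&` B = set0 -> mu (A `|` B) = (mu A + mu B)%R
      & forall (g : G) A, mu [set g * x | x in A] = mu A].

(* Elements of length at most n over the letters S and their inverses. *)
Fixpoint word_ball (G : groupType) (S : {fset G}) (n : nat) : {fset G} :=
  if n is m.+1 then
    (word_ball S m `|` [fset x * s | x in word_ball S m, s in S]
              `|` [fset x * s^-1 | x in word_ball S m, s in S])%fset
  else [fset 1]%fset.

Definition growth (G : groupType) (S : {fset G}) (n : nat) : nat :=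
  #|` word_ball S n|.

(* Growth is a notion about finitely generated groups; whether the limit is 1
   does not depend on the finite generating set. *)
Definition subexponential_growth (R : realType) (G : groupType) : Prop :=
  exists S : {fset G}, gen_set [set` S] = setT /\
    ((growth S n)%:R `^ (n%:R)^-1 : R)%R @[n --> \oo] --> (1%R : R).

Definition directed (I : Type) (le : I -> I -> Prop) : Prop :=
  [/\ inhabited I, forall i, le i i,
      forall i j k, le i j -> le j k -> le i k
    & forall i j, exists2 k, le i k & le j k].

Definition directed_system (I : Type) (le : I -> I -> Prop)
    (F : I -> groupType)
    (f : forall i j, le i j -> {multiplicative F i -> F j}) : Prop :=
  [/\ directed le,
      forall i (ii : le i i) x, f i i ii x = x
    & forall i j k (ij : le i j) (jk : le j k) (ik : le i k) x,
        f j k jk (f i j ij x) = f i k ik x].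

Definition is_cocone (I : Type) (le : I -> I -> Prop) (F : I -> groupType)
    (f : forall i j, le i j -> {multiplicative F i -> F j})
    (L : groupType) (c : forall i, {multiplicative F i -> L}) : Prop :=
  forall i j (ij : le i j) x, c j (f i j ij x) = c i x.

Definition is_direct_limit (I : Type) (le : I -> I -> Prop)
    (F : I -> groupType)
    (f : forall i j, le i j -> {multiplicative F i -> F j})
    (L : groupType) (c : forall i, {multiplicative F i -> L}) : Prop :=
  [/\ directed_system f, is_cocone f c
    & forall (H : groupType) (d : forall i, {multiplicative F i -> H}),
        is_cocone f d ->
        exists2 u : {multiplicative L -> H},
          forall i x, u (c i x) = d i x
        & forall u' : {multiplicative L -> H},
            (forall i x, u' (c i x) = d i x) -> u' =1 u].

(* Subgroups, quotients and extensions are given up to isomorphism: an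
   injective morphism, a surjective morphism, a short exact sequence. *)
Inductive SG (R : realType) : groupType -> Prop :=
| SG_growth (G : groupType) : subexponential_growth R G -> SG R G
| SG_subgroup (H G : groupType) (i : {multiplicative H -> G}) :
    injective i -> SG R G -> SG R H
| SG_quotient (G Q : groupType) (p : {multiplicative G -> Q}) :
    range p = setT -> SG R G -> SG R Q
| SG_extension (N E Q : groupType)
    (i : {multiplicative N -> E}) (p : {multiplicative E -> Q}) :
    injective i -> range i = [set x | p x = 1] -> range p = setT ->
    SG R N -> SG R Q -> SG R E
| SG_direct_limit (I : Type) (le : I -> I -> Prop) (F : I -> groupType)
    (f : forall i j, le i j -> {multiplicative F i -> F j})
    (L : groupType) (c : forall i, {multiplicative F i -> L}) :
    is_direct_limit f c -> (forall i, SG R (F i)) -> SG R L.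

Definition AG (R : realType) : groupType -> Prop := amenable R.

(* Vertices of the rooted binary tree are finite binary sequences, with false
   for 0 and true for 1; the root is the empty sequence. *)
Definition vertex := seq bool.

Definition edge (u v : vertex) : Prop := exists i : bool, v = rcons u i.

Definition is_tree_aut (f : vertex -> vertex) : Prop :=
  [/\ bijective f, f [::] = [::] & forall u v, edge (f u) (f v) <-> edge u v].

Record treeAut := TreeAut {
  aut_fun :> vertex -> vertex;
  aut_funP : `[< is_tree_aut aut_fun >]
}.

HB.instance Definition _ := [isSub for aut_fun].
HB.instance Definition _ := [Choice of treeAut by <:].

Lemma treeAutP (g h : treeAut) : g =1 h -> g = h.
Proof. by move=> gh; apply/val_inj/funext. Qed.

Fact aut_one_subproof : is_tree_aut id.
Proof. by split=> //; exists id. Qed.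

Definition aut_one := TreeAut (asboolT aut_one_subproof).

Fact aut_mul_subproof (g h : treeAut) : is_tree_aut (h \o g).
Proof.
have /asboolP[gb g0 gE] := aut_funP g; have /asboolP[hb h0 hE] := aut_funP h.
by split=> [||u v]; [exact: bij_comp|rewrite /= g0|rewrite /= hE gE].
Qed.

(* Automorphisms act on the right: the product g * h applies g first. *)
Definition aut_mul (g h : treeAut) := TreeAut (asboolT (aut_mul_subproof g h)).

Fact aut_inv_subproof (g : treeAut) :
  {f : vertex -> vertex | [/\ is_tree_aut f, cancel g f & cancel f g]}.
Proof.
apply: cid; have /asboolP[[f gK fK] g0 gE] := aut_funP g.
exists f; split=> //; split=> [||u v]; first by exists g.
  by rewrite -[in LHS]g0 gK.
by rewrite -gE !fK.
Qed.

Definition aut_inv (g : treeAut) : treeAut :=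
  let: exist f fP := aut_inv_subproof g in
  let: And3 faut _ _ := fP in TreeAut (asboolT faut).

Lemma aut_invK (g : treeAut) : cancel g (aut_inv g) /\ cancel (aut_inv g) g.
Proof. by rewrite /aut_inv; case: aut_inv_subproof => f []. Qed.

Fact aut_mulA : associative aut_mul. Proof. by move=> f g h; apply: treeAutP. Qed.
Fact aut_mul1 : left_id aut_one aut_mul. Proof. by move=> f; apply: treeAutP. Qed.
Fact aut_1mul : right_id aut_one aut_mul. Proof. by move=> f; apply: treeAutP. Qed.
Fact aut_mulV : left_inverse aut_one aut_inv aut_mul.
Proof. by move=> g; apply: treeAutP => v; exact: (aut_invK g).2 v. Qed.
Fact aut_Vmul : right_inverse aut_one aut_inv aut_mul.
Proof. by move=> g; apply: treeAutP => v; exact: (aut_invK g).1 v. Qed.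

HB.instance Definition _ := isGroup.Build treeAut
  aut_mulA aut_mul1 aut_1mul aut_mulV aut_Vmul.

Lemma autME (g h : treeAut) (v : vertex) : (g * h) v = h (g v).
Proof. by []. Qed.

(* [portrait s g h] applies g below the vertex 0 and h below the vertex 1, and
   then permutes these two subtrees if s is true. *)
Definition portrait_fun (s : bool) (g h : vertex -> vertex) (v : vertex) :=
  if v is i :: w then (i (+) s) :: (if i then h w else g w) else [::].

Lemma edge_cons (i j : bool) (u v : vertex) :
  edge (i :: u) (j :: v) <-> i = j /\ edge u v.
Proof.
split=> [[k [-> ->]]|[-> [k ->]]]; first by split=> //; exists k.
by exists k.
Qed.

Lemma edge_nil_cons (i : bool) (v : vertex) : edge [::] (i :: v) <-> v = [::].
Proof. by split=> [[k []]|->] //; exists i. Qed.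

Lemma edge_cons_nil (i : bool) (u : vertex) : ~ edge (i :: u) [::].
Proof. by case. Qed.

Fact portrait_subproof (s : bool) (g h : vertex -> vertex) :
  is_tree_aut g -> is_tree_aut h -> is_tree_aut (portrait_fun s g h).
Proof.
move=> [[g' gK gK'] g0 gE] [[h' hK hK'] h0 hE]; split=> //.
  exists (fun v => if v is i :: w then
    (i (+) s) :: (if i (+) s then h' w else g' w) else [::]).
  - by case=> [|i w] //=; rewrite addbK; case: i; rewrite ?hK ?gK.
  - by case=> [|i w] //=; rewrite addbK; case: (i (+) s); rewrite ?hK' ?gK'.
case=> [|i u] [|j v] /=.
- by split=> -[].
- rewrite !edge_nil_cons; case: j; split=> [E|->] //.
  + by apply: (can_inj hK); rewrite E.
  + by apply: (can_inj gK); rewrite E.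
- by split=> /edge_cons_nil.
- rewrite !edge_cons; split=> -[].
  + move=> /addIb ->; case: j => E; split=> //; [exact/hE|exact/gE].
  + by move=> <- E; split=> //; case: i => //; [exact/hE|exact/gE].
Qed.

Definition portrait (s : bool) (g h : treeAut) : treeAut :=
  TreeAut (asboolT (portrait_subproof s (asboolW (aut_funP g))
                                        (asboolW (aut_funP h)))).

Definition aut_pair (g h : treeAut) : treeAut := portrait false g h.
Definition aut_eps : treeAut := portrait true 1 1.

Lemma aut_pairE (g h : treeAut) (v : vertex) :
  [/\ aut_pair g h [::] = [::], aut_pair g h (false :: v) = false :: g v
    & aut_pair g h (true :: v) = true :: h v].
Proof. by []. Qed.

Lemma aut_epsE (i : bool) (v : vertex) :
  aut_eps [::] = [::] /\ aut_eps (i :: v) = ~~ i :: v.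
Proof. by split=> //=; rewrite addbT; case: i. Qed.

(* The action of a (for c = false) and of b (for c = true), obtained by
   unfolding a = (1, b) and b = (1, a) eps. *)
Fixpoint ab_fun (c : bool) (v : vertex) : vertex :=
  if v is i :: w then (i (+) c) :: (if i then ab_fun (~~ c) w else w)
  else [::].

Fact ab_fun_subproof (c : bool) : is_tree_aut (ab_fun c).
Proof.
pose finv := fix finv (c : bool) (v : vertex) : vertex :=
  if v is i :: w then (i (+) c) :: (if i (+) c then finv (~~ c) w else w)
  else [::].
have fK d : cancel (ab_fun d) (finv d).
  by move=> v; elim: v d => [|i w IH] d //=; rewrite addbK; case: i; rewrite ?IH.
have finvK d : cancel (finv d) (ab_fun d).
  move=> v; elim: v d => [|i w IH] d //=; rewrite addbK.
  by case: (i (+) d); rewrite ?IH.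
split=> //; first by exists (finv c).
move=> u; elim: u c => [|i u IH] c [|j v] /=.
- by split=> -[].
- rewrite !edge_nil_cons; case: j => //; split=> [E|->] //.
  exact: (can_inj (fK (~~ c))).
- by split=> /edge_cons_nil.
- rewrite !edge_cons; split=> -[].
  + by move=> /addIb ->; case: j => // /IH.
  + by move=> <- E; split=> //; case: i => //; exact/IH.
Qed.

Definition aut_a : treeAut := TreeAut (asboolT (ab_fun_subproof false)).
Definition aut_b : treeAut := TreeAut (asboolT (ab_fun_subproof true)).

Lemma aut_aE : aut_a = aut_pair 1 aut_b.
Proof. by apply: treeAutP => -[|[] w]. Qed.

Lemma aut_bE : aut_b = aut_pair 1 aut_a * aut_eps.
Proof. by apply: treeAutP => -[|[] w]. Qed.

Lemma aut_ab_unique (a b : treeAut) :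
  a = aut_pair 1 b -> b = aut_pair 1 a * aut_eps -> a = aut_a /\ b = aut_b.
Proof.
move=> aE bE.
have ab v : a v = ab_fun false v /\ b v = ab_fun true v.
  elim: v => [|i w [IHa IHb]]; first by rewrite bE autME aE.
  by split; [rewrite aE|rewrite bE autME]; case: i => //=; rewrite ?IHa ?IHb.
by split; apply: treeAutP => v; have [] := ab v.
Qed.

(* G = <a, b> *)
Definition basilica : groupType := gen_group [set aut_a; aut_b].

(* Main.v *)
Require Import Defs.
From HB Require Import structures.
From mathcomp Require Import all_boot all_order all_algebra finmap.
From mathcomp Require Import all_classical all_reals all_analysis.
From mathcomp Require Import zify ring lra.
Import numFieldNormedType.Exports.

Set Implicit Arguments.
Unset Strict Implicit.
Unset Printing Implicit Defensive.

Import Order.TTheory GRing.Theory Num.Theory.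
Local Open Scope classical_set_scope.
Local Open Scope group_scope.

(** The group G generated by a = (1, b) and b = (1, a) eps is amenable because
    a suitable random walk on it escapes slower than linearly, and it is not in SG because
    every nontrivial normal subgroup of G has G as a subquotient.

    Amenability.  Let r = sqrt(1/2) and let a step of the walk be a or a^-1 with
    weight r - 1/2 each, b or b^-1 with weight 1 - r each.  Write an element as
    g = (x, y) eps^s.  Multiplying g by a letter multiplies exactly one of x, y
    by a letter, and b, b^-1 also flip s.  Watched only when s is such that a
    multiplies it by b, each coordinate performs a delayed copy of the same
    walk: two successive flips multiply it by a or by a^-1 with probability 1/4
    each and leave it unchanged otherwise, and r is chosen to make these weights
    match.  The idle outcomes slow the walk down: the two coordinates together
    make on average r effective steps per step of g.

    At the level of functions, a function Phi on the tree automorphisms whose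
    mean grows by at most l along a step yields a function of the coordinates
    whose mean grows by at most r l ([lift_average], [potential_lift]), while
    the finiteness of the sum of exp(- Phi) over G survives ([lift_summable]).
    Iterating from the word length gives such functions with arbitrarily small
    growth ([small_potential]).  By convexity and the Cauchy-Schwarz inequality,
    for every e > 0 there is c > 0 such that the squared l2 norm of the law of
    the lazy walk after n steps is at least exp(- e n) / c
    ([energy_law_lower]).  Hence the norms of two successive laws have ratio
    close to 1 for some n, which makes this law an almost invariant vector
    ([almost_invariant_vector]); its square is an almost invariant probability,
    and an ultrafilter limit is an invariant mean
    ([amenable_of_almost_invariant]).

    Outside SG.  By induction on SG, no group in SG has G as a subquotient
    ([SG_not_involves]).  A group of subexponential growth does not, since
    different positive words of the same length in a and b are different
    elements of G ([word_inj]).  Subgroups, quotients and direct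
    limits inherit the property, G being finitely generated.  In an extension,
    the kernel meets the subquotient in a normal subgroup of G: if it is
    trivial, G is a subquotient of the quotient group; otherwise commutators and
    sections recover G inside the kernel ([involves_of_normal]). *)

(** * Generated subgroups *)

Section Generation.
Variables (H : groupType) (A : set H).

Lemma gen_set1 : gen_set A 1. Proof. by have [] := gen_set_subgroup A. Qed.
Lemma gen_setM x y : gen_set A x -> gen_set A y -> gen_set A (x * y).
Proof. by have [_ + _] := gen_set_subgroup A; apply. Qed.
Lemma gen_setV x : gen_set A x -> gen_set A x^-1.
Proof. by have [_ _] := gen_set_subgroup A; apply. Qed.
Lemma gen_set_gen x : A x -> gen_set A x.
Proof. by move=> Ax K [_]; apply. Qed.
Lemma gen_set_ind (K : set H) : is_subgroup K -> A `<=` K -> gen_set A `<=` K.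
Proof. by move=> Ksub AK x; apply. Qed.

End Generation.

(** * From almost invariant vectors to invariant means *)

Lemma fmap_ultra (T V : Type) (f : T -> V) (F : set_system T) :
  UltraFilter F -> UltraFilter (f @ F).
Proof.
move=> FU; split=> [|H HF sub]; first exact: fmap_proper_filter.
apply/seteqP; split=> // A HA.
have [//|nA] := in_ultra_setVsetC (f @^-1` A) FU.
have : H (A `&` ~` A) by apply: filterI => //; exact: sub.
by rewrite setICr => /filter_not_empty.
Qed.

Section Means.
Local Open Scope ring_scope.
Variables (R : realType) (G : groupType).
Implicit Types (A B : set G) (m w : set G -> R).

Definition finadd_probability w : Prop :=
  [/\ forall A, 0 <= w A, w setT = 1
    & forall A B, A `&` B = set0 -> w (A `|` B) = w A + w B].

Lemma finadd_le1 w A : finadd_probability w -> w A <= 1.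
Proof.
move=> [w0 w1 wU]; rewrite -w1 -(setUv A) wU ?setICr //.
by rewrite lerDl.
Qed.

(** The elements that preserve a mean under right translations form a subgroup,
    so the generators suffice; precomposing with inversion turns the right
    invariant mean into a left invariant one. *)
Lemma amenable_of_right_invariant (S : set G) m :
    gen_set S = setT -> finadd_probability m ->
    (forall s B, S s -> m [set x | B (x * s)%g] = m B) ->
  amenable R G.
Proof.
move=> genS [m0 m1 mU] mS.
have minv g B : m [set x | B (x * g)%g] = m B.
  pose K : set G := [set g | forall B, m [set x | B (x * g)%g] = m B].
  suff : K g by apply.
  have : gen_set S g by rewrite genS.
  apply: gen_set_ind => [|s Ss C]; last exact: mS.
  split=> [C|x y Kx Ky C|x Kx C].
  - by congr m; apply/funext => x /=; rewrite mulg1.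
  - rewrite -[RHS]Ky -[RHS]Kx; congr m; apply/funext => z /=.
    by rewrite mulgA.
  - rewrite -[LHS]Kx; congr m; apply/funext => z /=.
    by rewrite mulgK.
exists (fun A => m [set x | A x^-1%g]); split.
- by move=> A; exact: m0.
- exact: m1.
- move=> A B AB; rewrite -mU //; apply/seteqP; split=> // x [Ax Bx].
  by have : (A `&` B) x^-1%g by []; rewrite AB.
- move=> g A; rewrite -[RHS](minv g); congr m; apply/seteqP; split=> x /=.
    by move=> [y Ay xE]; rewrite invgM -xE mulKg.
  by move=> Ax; exists ((x * g)^-1)%g => //; rewrite invgM mulVKg.
Qed.

(** An ultrafilter limit, taken set by set, of probabilities that are more and
    more invariant under the generators is invariant. *)
Lemma amenable_of_almost_invariant (S : set G) :
    gen_set S = setT ->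
    (forall d : R, 0 < d -> exists2 w, finadd_probability w
      & forall s B, S s -> `|w [set x | B (x * s)%g] - w B| <= d) ->
  amenable R G.
Proof.
move=> genS approx.
have /choice[w wP] (n : nat) : exists w, finadd_probability w /\
    forall s B, S s -> `|w [set x | B (x * s)%g] - w B| <= n.+1%:R^-1.
  have [|w w1 w2] := approx n.+1%:R^-1; first by rewrite invr_gt0.
  by exists w.
have [U [UU Uoo]] := ultraFilterLemma (eventually_filter : ProperFilter \oo).
have /choice[m mP] B : exists l : R, w n B @[n --> U] --> l.
  have := @segment_compact R 0 1; rewrite compact_ultra.
  move=> /(_ (w n B @[n --> U]) (fmap_ultra _ UU)).
  case.
    rewrite /fmap /=; apply: filterE => n /=.
    have [w01 _] := wP n; rewrite in_itv /= finadd_le1 ?andbT //.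
    by case: w01.
  by move=> l [_ lP]; exists l.
have m_uniq B l : w n B @[n --> U] --> l -> m B = l.
  exact: (@cvg_unique R (@norm_hausdorff R R) (w n B @[n --> U]) _ _ _ (mP B)).
apply: (amenable_of_right_invariant (m := m)) genS _ _.
  split.
  - move=> A; rewrite leNgt; apply/negP => /(cvgr_lt _ (mP A))/filter_ex[n].
    by apply/negP; rewrite -leNgt; have [[]] := wP n.
  - apply: m_uniq; apply: cvg_near_cst; apply: filterE => n.
    by have [[]] := wP n.
  - move=> A B AB; apply: m_uniq.
    have -> : (fun n => w n (A `|` B)) = (fun n => w n A + w n B).
      by apply/funext => n; have [[_ _ ->]] := wP n.
    by apply: cvgD; exact: mP.
move=> s B Ss; apply/m_uniq.
have -> : (fun n => w n [set x | B (x * s)%g]) =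
    (fun n => w n B + (w n [set x | B (x * s)%g] - w n B)).
  by apply/funext => n; rewrite addrC subrK.
rewrite -[X in _ --> X]addr0; apply: cvgD; first exact: mP.
apply/cvgr0Pnorm_le => e e0.
apply: Uoo; near=> n.
have [_ /(_ s B Ss)/le_trans] := wP n; apply.
apply: ltW; near: n; exact: (near_infty_natSinv_lt (PosNum e0)).
Unshelve. all: by end_near.
Qed.

End Means.

(** * Random walks with slowly growing potentials *)

Section FiniteSupport.
Local Open Scope ring_scope.
Variables (R : realType) (T : choiceType).
Implicit Types f h : T -> R.

Definition fin_supp f := exists A : {fset T}, forall x, f x != 0 -> x \in A.

(** Sums over the whole type are used because they make translations plain
    reindexings; this lemma returns to an ordinary finite sum. *)
Lemma fsumE (A : {fset T}) f : (forall x, f x != 0 -> x \in A) ->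
  \sum_(x \in [set: T]) f x = \sum_(x <- A) f x.
Proof.
move=> fA; rewrite -(fsbig_widen [set` A] setT) //; last first.
  by move=> x [_ /= xA]; apply/eqP; apply: contra_notT xA => /fA.
by rewrite (fsbig_finite _ _ (finite_fset A)) set_fsetK.
Qed.

Lemma fin_suppD f h : fin_supp f -> fin_supp h -> fin_supp (fun x => f x + h x).
Proof.
move=> [A fA] [B hB]; exists (A `|` B)%fset => x.
rewrite in_fsetU; apply: contraR; rewrite negb_or => /andP[xA xB].
by rewrite (contraNeq (fA x) xA) (contraNeq (hB x) xB) addr0.
Qed.

Lemma fin_suppMl f h : fin_supp f -> fin_supp (fun x => f x * h x).
Proof.
move=> [A fA]; exists A => x; rewrite mulf_eq0 negb_or => /andP[fx _].
exact: fA.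
Qed.

Lemma fin_suppMr f h : fin_supp f -> fin_supp (fun x => h x * f x).
Proof.
move=> [A fA]; exists A => x; rewrite mulf_eq0 negb_or => /andP[_ fx].
exact: fA.
Qed.

Lemma fin_suppB f h : fin_supp f -> fin_supp h -> fin_supp (fun x => f x - h x).
Proof.
move=> fS hS; apply: fin_suppD => //.
have -> : (fun x => - h x) = (fun x => -1 * h x).
  by apply/funext => x; rewrite mulN1r.
exact: fin_suppMr.
Qed.

Lemma fsumD f h : fin_supp f -> fin_supp h ->
  \sum_(x \in [set: T]) (f x + h x) = \sum_(x \in [set: T]) f x + \sum_(x \in [set: T]) h x.
Proof.
move=> [A fA] [B hB].
have sA x : f x != 0 -> x \in (A `|` B)%fset by move/fA; rewrite in_fsetU => ->.
have sB x : h x != 0 -> x \in (A `|` B)%fset.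
  by move/hB; rewrite in_fsetU orbC => ->.
rewrite (fsumE sA) (fsumE sB) -big_split; apply: fsumE => x.
apply: contraR => xAB.
by rewrite (contraNeq (sA x) xAB) (contraNeq (sB x) xAB) addr0.
Qed.

Lemma fsumZ (c : R) f : \sum_(x \in [set: T]) (c * f x) = c * \sum_(x \in [set: T]) f x.
Proof. by rewrite mulr_fsumr. Qed.

Lemma ler_fsum f h : fin_supp f -> fin_supp h -> (forall x, f x <= h x) ->
  \sum_(x \in [set: T]) f x <= \sum_(x \in [set: T]) h x.
Proof.
move=> fS hS fh.
have -> : \sum_(x \in [set: T]) h x = \sum_(x \in [set: T]) (f x + (h x + (-1) * f x)).
  by apply: eq_fsbigr => x _; ring.
rewrite fsumD //; last by apply: fin_suppD => //; exact: fin_suppMr.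
by rewrite lerDl; apply: fsumr_ge0 => x _; rewrite mulN1r subr_ge0.
Qed.

Lemma fin_supp_sum (I : finType) (F : I -> T -> R) :
  (forall i, fin_supp (F i)) -> fin_supp (fun x => \sum_i F i x).
Proof.
move=> FS; elim: (index_enum I) => [|i r IH].
  by exists fset0 => x; rewrite big_nil eqxx.
have -> : (fun x => \sum_(j <- i :: r) F j x) =
    (fun x => F i x + \sum_(j <- r) F j x).
  by apply/funext => x; rewrite big_cons.
exact: fin_suppD.
Qed.

Lemma fsum_sum (I : finType) (F : I -> T -> R) : (forall i, fin_supp (F i)) ->
  \sum_(x \in [set: T]) (\sum_i F i x) = \sum_i \sum_(x \in [set: T]) F i x.
Proof.
move=> FS; elim: (index_enum I) => [|i r IH].
  rewrite big_nil; under eq_fsbigr do rewrite big_nil.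
  by rewrite fsbig1.
rewrite big_cons -IH; under eq_fsbigr do rewrite big_cons.
rewrite fsumD //; elim: r {IH} => [|j r IH].
  by exists fset0 => x; rewrite big_nil eqxx.
have -> : (fun x => \sum_(k <- j :: r) F k x) =
    (fun x => F j x + \sum_(k <- r) F k x).
  by apply/funext => x; rewrite big_cons.
exact: fin_suppD.
Qed.

End FiniteSupport.

Section LowerBound.
Local Open Scope ring_scope.

Lemma ler_sum_uniq (R : realType) (T : eqType) (u v : seq T) (h : T -> R) :
  (forall x, 0 <= h x) -> uniq u -> {subset u <= v} ->
  \sum_(x <- u) h x <= \sum_(x <- v) h x.
Proof.
move=> h0; elim: u v => [|x u IH] v /=.
  by move=> _ _; rewrite big_nil; exact: sumr_ge0.
move=> /andP[xu u_uniq] uv.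
have xv : x \in v by apply: uv; rewrite mem_head.
rewrite big_cons (perm_big _ (perm_to_rem xv)) big_cons lerD2l.
apply: IH => // y yu; have := uv y; rewrite inE yu orbT => /(_ isT).
rewrite (perm_mem (perm_to_rem xv)) inE => /orP[/eqP yx|//].
by move: xu; rewrite -yx yu.
Qed.

(** A finitely supported probability f with small mean of Phi cannot be spread
    out: Jensen bounds below the mean E of exp(- Phi / 2) by the exponential of
    minus half the mean of Phi, and Cauchy-Schwarz gives E ^ 2 <= K * Q, where
    Q is the squared l2 norm of f. *)
Lemma expR_lower (R : realType) (T : choiceType) (A : {fset T}) (f Phi : T -> R)
    (K : R) :
    (forall x, 0 <= f x) -> \sum_(x <- A) f x = 1 ->
    \sum_(x <- A) expR (- Phi x) <= K ->
  expR (- \sum_(x <- A) f x * Phi x) <= K * \sum_(x <- A) f x ^+ 2.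
Proof.
move=> f0 f1 leK; set m := \sum_(x <- A) f x * Phi x.
set Q := \sum_(x <- A) f x ^+ 2.
pose h x := expR (- Phi x / 2).
have hh x : h x ^+ 2 = expR (- Phi x).
  by rewrite expr2 -expRD -splitr.
pose E := \sum_(x <- A) f x * h x.
(* The tangent line of exp at - m / 2 lies below the graph. *)
have E_ge : expR (- m / 2) <= E.
  have -> : expR (- m / 2) =
      \sum_(x <- A) f x * (expR (- m / 2) * (1 + (m / 2 - Phi x / 2))).
    transitivity (expR (- m / 2) *
        ((1 + m / 2) * \sum_(x <- A) f x - 2^-1 * m)).
      by rewrite f1; field.
    rewrite mulrBr mulr_sumr /m !mulr_sumr -sumrB.
    by apply: eq_bigr => x _; field.
  apply: ler_sum => x _; apply: ler_wpM2l => //.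
  rewrite /h (_ : - Phi x / 2 = - m / 2 + (m / 2 - Phi x / 2)); last by field.
  rewrite expRD; apply: ler_wpM2l; rewrite ?expR_ge0 //.
  exact: expR_ge1Dx.
have E0 : 0 < E by apply: lt_le_trans E_ge; exact: expR_gt0.
(* Termwise this is (f x - t * h x) ^ 2 >= 0. *)
have quad t : 2 * t * E - t ^+ 2 * K <= Q.
  apply: (@le_trans _ _ (2 * t * E - t ^+ 2 * \sum_(x <- A) expR (- Phi x))).
    by apply: lerB => //; apply: ler_wpM2l => //; exact: sqr_ge0.
  rewrite /E !mulr_sumr -sumrB; apply: ler_sum => x _.
  by rewrite -hh -subr_ge0; have := sqr_ge0 (f x - t * h x); lra.
have K0 : 0 < K.
  apply: lt_le_trans leK; rewrite lt_neqAle sumr_ge0 ?andbT; last first.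
    by move=> x _; exact: expR_ge0.
  apply/negP => /eqP/esym/eqP; rewrite psumr_eq0; last by move=> x _; exact: expR_ge0.
  move=> /allP/= A0; move: f1; rewrite big_seq big1 => [/esym/eqP|x /A0].
    by rewrite oner_eq0.
  by rewrite expR_eq0.
have := quad (E / K).
have -> : 2 * (E / K) * E - (E / K) ^+ 2 * K = E ^+ 2 / K.
  by field; rewrite gt_eqF.
rewrite ler_pdivrMr // [Q * K]mulrC; apply: le_trans.
rewrite (splitr (- m)) expRD expr2; apply: ler_pM => //; exact: expR_ge0.
Qed.

End LowerBound.

Section Shift.
Local Open Scope ring_scope.
Variables (R : realType) (G : groupType) (f : G -> R) (g : G).

Lemma fin_supp_shift : fin_supp f -> fin_supp (fun x => f (x * g)%g).
Proof.
move=> [A fA]; exists [fset y * g^-1 | y in A]%g%fset => x /fA xA.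
by apply/imfsetP; exists (x * g)%g => //; rewrite mulgK.
Qed.

Lemma fsum_shift : \sum_(x \in [set: G]) f (x * g)%g = \sum_(x \in [set: G]) f x.
Proof.
rewrite -(reindex_fsbigT (fun x => x * g)%g) //.
by exists (fun x => x * g^-1)%g => x; rewrite ?mulgK ?mulgVK.
Qed.

End Shift.

Section Walk.
Local Open Scope ring_scope.
Variables (R : realType) (G : groupType) (I : finType).
Variables (p : I -> R) (s : I -> G).
Hypothesis p_gt0 : forall i, 0 < p i.
Hypothesis p_sum : \sum_i p i = 1.

(** The law of the walk g, g s_i, g s_i s_j and so on evolves by [step]. *)
Definition step (f : G -> R) (x : G) : R := \sum_i p i * f (x * (s i)^-1)%g.

Definition law n : G -> R := iter n step (fun x => (x == 1%g)%:R).

Definition energy (f : G -> R) : R := \sum_(x \in [set: G]) f x ^+ 2.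

Lemma fin_supp_sqr (f : G -> R) : fin_supp f -> fin_supp (fun x => f x ^+ 2).
Proof. exact: fin_suppMl. Qed.

Lemma fin_supp_step (f : G -> R) : fin_supp f -> fin_supp (step f).
Proof.
by move=> fS; apply: fin_supp_sum => i; apply/fin_suppMr/fin_supp_shift.
Qed.

(** The evolution of laws is dual to averaging functions along a step. *)
Lemma fsum_step (f : G -> R) (phi : G -> R) : fin_supp f ->
  \sum_(x \in [set: G]) (step f x * phi x) = \sum_(x \in [set: G]) (f x * \sum_i p i * phi (x * s i)%g).
Proof.
move=> fS; under eq_fsbigr do rewrite /step mulr_suml.
rewrite fsum_sum; last first.
  by move=> i; apply/fin_suppMl/fin_suppMr/fin_supp_shift.
under [RHS]eq_fsbigr do rewrite mulr_sumr.
rewrite fsum_sum; last by move=> i; exact: fin_suppMl.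
apply: eq_bigr => i _.
rewrite -[LHS](fsum_shift _ (s i)); apply: eq_fsbigr => x _.
by rewrite mulgK; ring.
Qed.

(** One step averages translates of f, which all have the energy of f, so the
    energy lost is the variance of the translates around their average; the
    i-th one contributes the left-hand side. *)
Lemma energy_step (f : G -> R) i : fin_supp f ->
  p i * \sum_(x \in [set: G]) (f (x * (s i)^-1)%g - step f x) ^+ 2 <= energy f - energy (step f).
Proof.
move=> fS; have DS := fin_supp_step fS.
have shS j : fin_supp (fun x => f (x * (s j)^-1)%g) by exact: fin_supp_shift.
have dS j : fin_supp (fun x => (f (x * (s j)^-1)%g - step f x) ^+ 2).
  by apply: fin_supp_sqr; exact: fin_suppB.
have pointwise x : \sum_j p j * (f (x * (s j)^-1)%g - step f x) ^+ 2 =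
    \sum_j p j * f (x * (s j)^-1)%g ^+ 2 + -1 * step f x ^+ 2.
  have : step f x = \sum_j p j * f (x * (s j)^-1)%g by [].
  move: (step f x) => D DE.
  transitivity (\sum_j p j * f (x * (s j)^-1)%g ^+ 2
    - 2 * D * D + D ^+ 2 * \sum_j p j).
    rewrite {3}DE !mulr_sumr -sumrB -big_split /=; apply: eq_bigr => j _.
    by ring.
  by rewrite p_sum; ring.
have -> : energy f - energy (step f) =
    \sum_j p j * \sum_(x \in [set: G]) (f (x * (s j)^-1)%g - step f x) ^+ 2.
  under [RHS]eq_bigr do rewrite -fsumZ.
  rewrite -fsum_sum; last by move=> j; exact: fin_suppMr.
  under [RHS]eq_fsbigr do rewrite pointwise.
  rewrite fsumD; first last.
  - exact/fin_suppMr/fin_supp_sqr.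
  - by apply: fin_supp_sum => j; apply/fin_suppMr/fin_supp_sqr.
  rewrite fsumZ mulN1r; congr (_ - _).
  rewrite fsum_sum; last by move=> j; apply/fin_suppMr/fin_supp_sqr.
  under eq_bigr => j _ do
    rewrite fsumZ (fsum_shift (fun x => f x ^+ 2) (s j)^-1%g).
  by rewrite -mulr_suml p_sum mul1r.
rewrite [leRHS](bigD1 i) //= lerDl; apply: sumr_ge0 => j _.
by apply: mulr_ge0; [exact: ltW|apply: fsumr_ge0 => x _; exact: sqr_ge0].
Qed.

Lemma law_supp n : fin_supp (law n).
Proof.
elim: n => [|n IH]; last exact: fin_supp_step.
by exists [fset 1%g]%fset => x; rewrite inE /law /=; case: (x == 1%g); rewrite ?eqxx.
Qed.

Lemma law_ge0 n x : 0 <= law n x.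
Proof.
elim: n x => [|n IH] x /=; first exact: ler0n.
by apply: sumr_ge0 => i _; apply: mulr_ge0; [exact: ltW|exact: IH].
Qed.

Lemma law_fsum0 (phi : G -> R) : \sum_(x \in [set: G]) (law 0 x * phi x) = phi 1%g.
Proof.
rewrite (@fsumE _ _ [fset 1%g]%fset) => [|x]; last first.
  by rewrite inE /law /=; case: (x == 1%g) => //; rewrite mul0r eqxx.
by rewrite big_seq_fset1 /= eqxx mul1r.
Qed.

Lemma law_drift (Phi : G -> R) e n :
    (forall g, \sum_i p i * Phi (g * s i)%g <= Phi g + e) ->
  \sum_(x \in [set: G]) (law n x) = 1 /\ \sum_(x \in [set: G]) (law n x * Phi x) <= Phi 1%g + n%:R * e.
Proof.
move=> drift; elim: n => [|n [IH1 IH2]].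
  split; last by rewrite law_fsum0 mul0r addr0.
  by rewrite -[RHS](law_fsum0 (fun=> 1)); apply: eq_fsbigr => x _; rewrite mulr1.
have lS := law_supp n.
have E1 : \sum_(x \in [set: G]) (law n.+1 x) = 1.
  transitivity (\sum_(x \in [set: G]) (step (law n) x * 1)).
    by apply: eq_fsbigr => x _; rewrite mulr1.
  rewrite fsum_step // -[RHS]IH1; apply: eq_fsbigr => x _.
  by rewrite -mulr_suml p_sum !mulr1.
split=> //; rewrite [X in X <= _]fsum_step //.
apply: (@le_trans _ _ (\sum_(x \in [set: G]) (law n x * Phi x + e * law n x))).
  apply: ler_fsum => [| |x].
  - exact: fin_suppMl.
  - by apply: fin_suppD; [exact: fin_suppMl|exact: fin_suppMr].
  - rewrite [e * _]mulrC -mulrDr; apply: ler_wpM2l => //; exact: law_ge0.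
rewrite fsumD ?fsumZ ?IH1; [|exact: fin_suppMl|exact: fin_suppMr].
by rewrite mulr1 -natr1; lra.
Qed.

(** The sum condition says that exp(- Phi) has finite total mass, so that a
    small mean of Phi forces a law to be concentrated. *)
Hypothesis potential : forall e : R, 0 < e -> exists (Phi : G -> R) K,
  (forall g, \sum_i p i * Phi (g * s i)%g <= Phi g + e) /\
  (forall A : {fset G}, \sum_(x <- A) expR (- Phi x) <= K).

(** The walk has mean potential at most Phi 1 + n e after n steps, and
    [expR_lower] turns this into a lower bound for its energy. *)
Lemma energy_law_lower e : 0 < e ->
  exists2 c : R, 0 < c & forall n, expR (- (n%:R * e)) <= c * energy (law n).
Proof.
move=> e0; have [Phi [K [drift sumK]]] := potential e0.
have K0 : 0 < K.
  apply: lt_le_trans (sumK [fset 1%g]%fset).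
  by rewrite big_seq_fset1 expR_gt0.
exists (expR (Phi 1%g) * K) => [|n]; first by rewrite mulr_gt0 ?expR_gt0.
have [A lA] := law_supp n; have [l1 lPhi] := law_drift n drift.
rewrite -mulrA -ler_pdivrMl ?expR_gt0 // -expRN -expRD.
rewrite /energy (@fsumE _ _ A) => [|x]; last first.
  by rewrite sqrf_eq0; exact: lA.
apply: le_trans (expR_lower (Phi := Phi) _ _ _) => //; last first.
- by rewrite -(fsumE lA).
- exact: law_ge0.
rewrite ler_expR -opprD lerN2.
rewrite -(@fsumE _ _ A (fun x => law n x * Phi x)) // => x.
by rewrite mulf_eq0 negb_or => /andP[/lA].
Qed.

Lemma energy_law_gt0 n : 0 < energy (law n).
Proof.
have [c c0 /(_ n)] := energy_law_lower (@ltr01 R).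
move/(lt_le_trans (expR_gt0 _)); by rewrite pmulr_rgt0.
Qed.

(** Otherwise the energy would decay exponentially, against
    [energy_law_lower]. *)
Lemma energy_ratio eta : 0 < eta ->
  exists n, energy (law n) - energy (law n.+1) <= eta * energy (law n).
Proof.
move=> eta0; apply: contrapT => /forallNP dec.
have {}dec n : energy (law n.+1) <= expR (- eta) * energy (law n).
  have := dec n; move=> /negP; rewrite -ltNge => lt_n.
  apply: (@le_trans _ _ ((1 - eta) * energy (law n))); first lra.
  by rewrite ler_pM2r ?energy_law_gt0 //; exact: expR_ge1Dx.
have decn n : energy (law n) <= expR (- (n%:R * eta)) * energy (law 0).
  elim: n => [|n IH]; first by rewrite mul0r oppr0 expR0 mul1r.
  apply: le_trans (dec n) _.
  rewrite -natr1 mulrDl mul1r opprD addrC expRD -mulrA.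
  by rewrite ler_pM2l ?expR_gt0.
have [c c0 low] := energy_law_lower (divr_gt0 eta0 (@ltr0Sn R 1)).
have bound n : 1 + n%:R * (eta / 2) <= c * energy (law 0).
  apply: le_trans (expR_ge1Dx _) _.
  rewrite -(ler_pM2l (expR_gt0 (- (n%:R * eta)))) -expRD.
  rewrite (_ : - _ + _ = - (n%:R * (eta / 2))); last by field.
  apply: le_trans (low n) _.
  by rewrite mulrCA ler_pM2l.
have := archi_boundP (ltW (divr_gt0 (mulr_gt0 c0 (energy_law_gt0 0))
  (divr_gt0 eta0 (@ltr0Sn R 1)))).
set N := Num.bound _; rewrite ltr_pdivrMr ?divr_gt0 //.
by have := bound N; lra.
Qed.

Variable i0 : I.
Hypothesis s_i0 : s i0 = 1%g.

(** When one more step loses little energy, all translates of the law are close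
    to their average by [energy_step].  The walk being lazy, the law itself is
    one of these translates, hence is close to the others. *)
Lemma almost_invariant_vector e : 0 < e -> exists2 f, fin_supp f &
  0 < energy f /\
  forall i, \sum_(x \in [set: G]) (f (x * (s i)^-1)%g - f x) ^+ 2 <= e * energy f.
Proof.
move=> e0.
(* A positive lower bound for all the weights, as p i <= 1. *)
pose q := \prod_i p i.
have q_le i : 0 < q <= p i.
  have p_le1 j : p j <= 1.
    rewrite -p_sum (bigD1 j) //= lerDl; apply: sumr_ge0 => k _; exact: ltW.
  rewrite prodr_gt0 //= /q (bigD1 i) //=; apply: ler_piMr; first exact: ltW.
  by apply: prodr_ile1 => j _; rewrite p_le1 ltW.
have q0 : 0 < q by case/andP: (q_le i0).
have [n ratio] := energy_ratio (mulr_gt0 (divr_gt0 e0 (@ltr0Sn R 3)) q0).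
set f := law n in ratio; have fS : fin_supp f := law_supp n.
exists f => //; split=> [|i]; first exact: energy_law_gt0.
have close j : \sum_(x \in [set: G]) (f (x * (s j)^-1)%g - step f x) ^+ 2 <= e / 4 * energy f.
  have /andP[_ qj] := q_le j.
  rewrite -(ler_pM2l q0) [leRHS]mulrA [q * (e / 4)]mulrC.
  apply: le_trans ratio; apply: le_trans (energy_step j fS).
  apply: ler_wpM2r => //; apply: fsumr_ge0 => x _; exact: sqr_ge0.
have dS j : fin_supp (fun x => (f (x * (s j)^-1)%g - step f x) ^+ 2).
  apply: fin_supp_sqr; apply: fin_suppB; first exact: fin_supp_shift.
  exact: fin_supp_step.
apply: (@le_trans _ _ (\sum_(x \in [set: G]) (2 * (f (x * (s i)^-1)%g - step f x) ^+ 2 +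
                             2 * (f (x * (s i0)^-1)%g - step f x) ^+ 2))).
  apply: ler_fsum => [| |x].
  - by apply: fin_supp_sqr; apply: fin_suppB => //; exact: fin_supp_shift.
  - by apply: fin_suppD; exact: fin_suppMr.
  - rewrite s_i0 invg1 mulg1 -subr_ge0.
    have := sqr_ge0 (f (x * (s i)^-1)%g + f x - 2 * step f x); lra.
rewrite fsumD ?fsumZ; [|exact: fin_suppMr|exact: fin_suppMr].
by have := close i; have := close i0; lra.
Qed.

(** The normalized square of an almost invariant vector is an almost invariant
    probability, since u^2 - v^2 = (u - v) (u + v). *)
Lemma walk_almost_invariant d : 0 < d -> exists2 w : set G -> R,
  finadd_probability w &
  forall i B, `|w [set x | B (x * s i)%g] - w B| <= d.
Proof.
move=> d0; pose e := d / 3.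
have e0 : 0 < e by rewrite divr_gt0.
have [f fS [En inv]] := almost_invariant_vector (mulr_gt0 e0 e0).
pose ind (B : set G) x : R := (`[< B x >])%:R.
pose w B := (energy f)^-1 * \sum_(x \in [set: G]) (f x ^+ 2 * ind B x).
have f2S := fin_supp_sqr fS.
exists w => [|i B].
  split=> [A| |A B AB].
  - apply: mulr_ge0; first by rewrite invr_ge0 ltW.
    by apply: fsumr_ge0 => x _; rewrite mulr_ge0 ?sqr_ge0 ?ler0n.
  - rewrite /w (_ : \sum_(x \in [set: G]) _ = energy f) ?mulVf ?gt_eqF //.
    by apply: eq_fsbigr => x _; rewrite /ind asboolT // mulr1.
  - rewrite /w -mulrDr -fsumD; [|exact: fin_suppMl|exact: fin_suppMl].
    congr (_ * _); apply: eq_fsbigr => x _.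
    rewrite -mulrDr; congr (_ * _); rewrite /ind asbool_or.
    case: asboolP => Ax; case: asboolP => Bx; rewrite ?addr0 ?add0r //.
    by have : (A `&` B) x by []; rewrite AB.
have -> : w [set x | B (x * s i)%g] =
    (energy f)^-1 * \sum_(x \in [set: G]) (f (x * (s i)^-1)%g ^+ 2 * ind B x).
  congr (_ * _).
  rewrite -(fsum_shift (fun x => f (x * (s i)^-1)%g ^+ 2 * ind B x) (s i)).
  by apply: eq_fsbigr => x _; rewrite mulgK.
have shS : fin_supp (fun x => f (x * (s i)^-1)%g) by exact: fin_supp_shift.
have sh2S := fin_supp_sqr shS.
rewrite -mulrBr normrM gtr0_norm ?invr_gt0 // ler_pdivrMl // mulrC.
(* The arithmetic-geometric mean inequality applied to (u - v) (u + v); the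
   first summand has a small sum because f is almost invariant, the second
   one because of the factor e. *)
pose bnd x := (2 * e)^-1 * (f (x * (s i)^-1)%g - f x) ^+ 2 +
              e * (f (x * (s i)^-1)%g ^+ 2 + f x ^+ 2).
have bndS : fin_supp bnd.
  apply: fin_suppD; apply: fin_suppMr; last exact: fin_suppD.
  by apply: fin_supp_sqr; exact: fin_suppB.
have bnd_le : \sum_(x \in [set: G]) bnd x <= d * energy f.
  rewrite fsumD; [| |by apply: fin_suppMr; exact: fin_suppD]; last first.
    by apply: fin_suppMr; apply: fin_supp_sqr; exact: fin_suppB.
  rewrite !fsumZ fsumD // (fsum_shift (fun x => f x ^+ 2)).
  apply: (@le_trans _ _ ((2 * e)^-1 * (e * e * energy f) +
                         e * (energy f + energy f))).
    by rewrite lerD2r ler_pM2l ?invr_gt0 ?mulr_gt0.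
  rewrite (_ : _ + _ = (e / 2 + 2 * e) * energy f); last by field; rewrite gt_eqF.
  by rewrite ler_pM2r // /e; lra.
apply: le_trans bnd_le.
have pointwise x : `|f (x * (s i)^-1)%g ^+ 2 * ind B x - f x ^+ 2 * ind B x| <= bnd x.
  set u := f _; set v := f x.
  have uv : `|u ^+ 2 - v ^+ 2| <= bnd x.
    rewrite /bnd -/u -/v ler_norml.
    have S : 0 <= e / 2 * (u - v) ^+ 2.
      by rewrite mulr_ge0 ?sqr_ge0 // divr_ge0 // ltW.
    have P c : 0 <= (u - v + c * (u + v)) ^+ 2 / (2 * e).
      by rewrite divr_ge0 ?sqr_ge0 // mulr_ge0 // ltW.
    have eN0 : e != 0 by rewrite gt_eqF.
    have PE : (2 * e)^-1 * (u - v) ^+ 2 + e * (u ^+ 2 + v ^+ 2) =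
        (u ^+ 2 - v ^+ 2) + (u - v + - e * (u + v)) ^+ 2 / (2 * e) +
        e / 2 * (u - v) ^+ 2 by field.
    have ME : (2 * e)^-1 * (u - v) ^+ 2 + e * (u ^+ 2 + v ^+ 2) =
        - (u ^+ 2 - v ^+ 2) + (u - v + e * (u + v)) ^+ 2 / (2 * e) +
        e / 2 * (u - v) ^+ 2 by field.
    apply/andP; split; last by rewrite PE -addrA lerDl addr_ge0.
    by rewrite lerNl ME -addrA lerDl addr_ge0.
  rewrite -mulrBl normrM /ind; case: asboolP => _; first by rewrite normr1 mulr1.
  by rewrite normr0 mulr0; apply: le_trans uv.
have compare (g h : G -> R) : fin_supp g -> fin_supp h ->
    (forall x, `|g x - h x| <= bnd x) ->
    \sum_(x \in [set: G]) g x <=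
    \sum_(x \in [set: G]) h x + \sum_(x \in [set: G]) bnd x.
  move=> gS hS gh; rewrite -fsumD //; apply: ler_fsum => // [|x].
    exact: fin_suppD.
  by rewrite -lerBlDl; apply: le_trans (gh x); exact: ler_norm.
rewrite ler_norml; apply/andP; split.
  rewrite lerNl opprB lerBlDl; apply: compare => [| |x].
  - exact: fin_suppMl.
  - exact: fin_suppMl.
  - by rewrite distrC; exact: pointwise.
by rewrite lerBlDl; apply: compare => //; exact: fin_suppMl.
Qed.


(** Kesten's argument with the return probabilities estimated through
    potentials instead of a growth condition. *)
Theorem amenable_of_slow_potentials :
  gen_set (range s) = setT -> amenable R G.
Proof.
move=> genS; apply: (amenable_of_almost_invariant genS) => d d0.
have [w wP wi] := walk_almost_invariant d0.
by exists w => // _ B [i _ <-]; exact: wi.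
Qed.

End Walk.

(** * Portraits of tree automorphisms *)

Local Notation a := aut_a.
Local Notation b := aut_b.
Local Notation G := (gen_set [set aut_a; aut_b]).

Section TreeCalculus.
Implicit Types (g h x y : treeAut) (s t : bool).

Lemma portraitM s g h t g' h' :
  portrait s g h * portrait t g' h' =
  portrait (s (+) t) (g * (if s then h' else g')) (h * (if s then g' else h')).
Proof.
by apply: treeAutP => -[|i w]; rewrite !autME //= -addbA; case: i; case: s.
Qed.

Lemma portrait1 : portrait false 1 1 = 1.
Proof. by apply: treeAutP => -[|[] w]. Qed.

Lemma portraitV s g h :
  (portrait s g h)^-1 =
  portrait s (if s then h^-1 else g^-1) (if s then g^-1 else h^-1).
Proof.
apply: mulg1_eq; rewrite portraitM addbb -portrait1.
by case: s; rewrite !mulgV.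
Qed.

Lemma portrait_inj s g h s' g' h' :
  portrait s g h = portrait s' g' h' -> [/\ s = s', g = g' & h = h'].
Proof.
move=> E.
have e i v : portrait s g h (i :: v) = portrait s' g' h' (i :: v) by rewrite E.
split.
- by have /= [] := e false [::].
- by apply: treeAutP => v; have /= [] := e false v.
- by apply: treeAutP => v; have /= [] := e true v.
Qed.

(** Preservation of edges makes the image of the first letter of a vertex
    depend on that letter only, and the rest of the vertex is then mapped by an
    automorphism that depends on that letter. *)
Lemma ex_portrait g : exists s x y, g = portrait s x y.
Proof.
have aut_head (f : treeAut) : f [::] = [::] by have /asboolP[] := aut_funP f.
have aut_edge (f : treeAut) u v : edge (f u) (f v) <-> edge u v.
  by have /asboolP[] := aut_funP f.
have aut_bij (f : treeAut) : injective f.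
  by have /asboolP[/bij_inj] := aut_funP f.
have img1 i : exists j, g [:: i] = [:: j].
  have : edge (g [::]) (g [:: i]) by apply/aut_edge; exists i.
  by rewrite aut_head => -[j ->]; exists j.
have [s0 Es0] := img1 false; have [s1 Es1] := img1 true.
have ns : s1 = ~~ s0.
  have : s0 <> s1 by move=> E; move: Es1; rewrite -E -Es0 => /aut_bij.
  by case: s0 s1 {Es0 Es1} => -[].
have below i w : g (i :: w) = (i (+) s0) :: behead (g (i :: w)).
  elim/last_ind: w => [|w j IH].
    by case: i => /=; rewrite ?Es0 ?Es1 ?ns.
  have : edge (g (i :: w)) (g (i :: rcons w j)).
    by apply/aut_edge; exists j; rewrite -rcons_cons.
  by rewrite {1}IH => -[k ->].
pose sec i w := behead (g (i :: w)).
have secP i : is_tree_aut (sec i).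
  have gE w : g (i :: w) = (i (+) s0) :: sec i w by rewrite below.
  split.
  - exists (fun w => behead (g^-1 ((i (+) s0) :: w))).
      by move=> w /=; rewrite -gE -[g^-1 _]/((g * g^-1) _) mulgV.
    move=> w /=; set u := g^-1 _.
    have gu : g u = (i (+) s0) :: w by rewrite -[g u]/((g^-1 * g) _) mulVg.
    case: u gu => [|j u] /=; first by rewrite aut_head.
    rewrite below => -[/addIb -> <-]; by [].
  - by rewrite /sec; case: i {gE} => /=; rewrite ?Es0 ?Es1.
  - move=> u v; have := aut_edge g (i :: u) (i :: v); rewrite !gE !edge_cons.
    by tauto.
exists s0, (TreeAut (asboolT (secP false))), (TreeAut (asboolT (secP true))).
apply: treeAutP => -[|i w]; first by rewrite aut_head.
by rewrite below /= /sec; case: i.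
Qed.

Lemma aP : a = portrait false 1 b. Proof. exact: aut_aE. Qed.
Lemma bP : b = portrait true 1 a.
Proof. by apply: treeAutP => -[|[] w]. Qed.
Lemma aVP : a^-1 = portrait false 1 b^-1.
Proof. by rewrite {1}aP portraitV invg1. Qed.
Lemma bVP : b^-1 = portrait true a^-1 1.
Proof. by rewrite {1}bP portraitV invg1. Qed.

End TreeCalculus.

Lemma Ga : G a. Proof. by apply: gen_set_gen; left. Qed.
Lemma Gb : G b. Proof. by apply: gen_set_gen; right. Qed.


(** * Positive words and exponential growth *)

(** The letter false stands for x and true for y. *)
Definition word (T : groupType) (x y : T) (w : seq bool) : T :=
  foldr (fun c z => (if c then y else x) * z) 1 w.

(** The sections at 0 and 1 of a positive word in a and b are again positive
    words, and each letter contributes to exactly one of them. *)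
Fixpoint word_sections (w : seq bool) : seq bool * seq bool :=
  if w is c :: w' then
    let: (u, v) := word_sections w' in
    if c then (v, false :: u) else (u, true :: v)
  else ([::], [::]).

Lemma word_portrait w :
  word a b w = portrait (odd (count id w)) (word a b (word_sections w).1)
                        (word a b (word_sections w).2).
Proof.
elim: w => [|c w IH] /=; first by rewrite portrait1.
case: (word_sections w) IH => u v /= ->.
by case: c => /=; [rewrite [X in X * _]bP|rewrite [X in X * _]aP];
  rewrite portraitM /= mul1g.
Qed.

Lemma size_word_sections w :
  (size (word_sections w).1 + size (word_sections w).2 = size w)%N.
Proof.
elim: w => //= c w; case: (word_sections w) => u v /= <-.
by case: c => /=; lia.
Qed.

Lemma word_sections2_nil w : ((word_sections w).2 == [::]) = (w == [::]).
Proof. by case: w => //= c w; case: (word_sections w) => u v; case: c. Qed.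

(** The sections at 1 of two equal elements a u and b v start with b and with a
    respectively, so they form a pair of the same kind.  Since b v has a
    nonempty section at 0 unless v is empty, the total length decreases; when
    v is empty it need not, but then the new word starting with b has length at
    least two, which the second summand of the measure detects. *)
Lemma word_head_neq u v : word a b (false :: u) <> word a b (true :: v).
Proof.
have [n] := ubnP (2 * (size u + size v) + (v == [::]))%N.
elim: n u v => // n IH u v lt_n uv.
have := uv; rewrite (word_portrait (false :: u)) (word_portrait (true :: v)) /=.
have := size_word_sections u; have := size_word_sections v.
have := word_sections2_nil u; have := word_sections2_nil v.
case: (word_sections u) => u0 u1; case: (word_sections v) => v0 v1 /=.
move=> nv nu sv su /portrait_inj[par _ /esym /IH]; apply.
have [v_nil|v_nil] := eqVneq v [::].
  have u_nil : u != [::] by apply: contra_eq_neq par => ->; rewrite v_nil.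
  by move: lt_n sv; rewrite nu (negPf u_nil) v_nil /=; lia.
have : (0 < size v1)%N by move: nv; case: (v1) => //; rewrite (negPf v_nil).
by move: lt_n; rewrite (negPf v_nil); case: (_ == _) => /=; lia.
Qed.

Lemma word_inj w w' : size w = size w' -> word a b w = word a b w' -> w = w'.
Proof.
elim: w w' => [|c w IH] [|c' w'] //= [sz] E.
have [cc|] := eqVneq c c'.
  by move: E; rewrite -cc => /mulgI/IH ->.
case: c c' E => -[] // E _; last by case: (word_head_neq E).
by case: (word_head_neq (esym E)).
Qed.

Section Balls.
Variables (H : groupType) (S : {fset H}).
Local Open Scope fset_scope.

Lemma word_ballSP n x : reflect
  (x \in word_ball S n \/
   exists2 y, y \in word_ball S n & exists2 s, s \in S & x = y * s \/ x = y * s^-1)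
  (x \in word_ball S n.+1).
Proof.
apply: (iffP idP) => /=.
  rewrite !inE => /orP[/orP[|/imfset2P]|/imfset2P]; first by left.
  - by move=> [y yS [s sS ->]]; right; exists y => //; exists s => //; left.
  - by move=> [y yS [s sS ->]]; right; exists y => //; exists s => //; right.
rewrite !inE => -[->//|[y yB [s sS [->|->]]]].
- apply/orP; left; apply/orP; right; apply/imfset2P.
  by exists y => //; exists s.
- by apply/orP; right; apply/imfset2P; exists y => //; exists s.
Qed.

Lemma word_ball_le m n : (m <= n)%N -> word_ball S m `<=` word_ball S n.
Proof.
elim: n => [|n IH]; first by rewrite leqn0 => /eqP ->.
rewrite leq_eqVlt => /orP[/eqP -> //|/IH le_mn].
by apply: fsubset_trans le_mn _; apply/fsubsetP => x xB; apply/word_ballSP; left.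
Qed.

Lemma word_ballM m n x y :
  x \in word_ball S m -> y \in word_ball S n -> x * y \in word_ball S (m + n).
Proof.
move=> xB; elim: n y => [|n IH] y; first by rewrite addn0 inE => /eqP ->; rewrite mulg1.
rewrite addnS => /word_ballSP[/IH yB|[z /IH zB [s sS yE]]].
  by apply/word_ballSP; left.
apply/word_ballSP; right; exists (x * z) => //; exists s => //.
by case: yE => ->; [left|right]; rewrite mulgA.
Qed.

Lemma word_ball_letter s : s \in S ->
  s \in word_ball S 1 /\ s^-1 \in word_ball S 1.
Proof.
have B0 : 1 \in word_ball S 0 by rewrite inE.
by move=> sS; split; apply/word_ballSP; right; exists 1 => //; exists s => //;
  rewrite !mul1g; [left|right].
Qed.

Lemma word_ballV n x : x \in word_ball S n -> x^-1 \in word_ball S n.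
Proof.
elim: n x => [|n IH] x; first by rewrite !inE => /eqP ->; rewrite invg1.
case/word_ballSP => [/IH xB|[y /IH yB [s /word_ball_letter[sB sVB] xE]]].
  by apply/word_ballSP; left.
by rewrite -add1n; case: xE => ->; rewrite invgM ?invgK; exact: word_ballM.
Qed.

Lemma gen_set_word_ball x : gen_set [set` S] x -> exists n, x \in word_ball S n.
Proof.
apply: (@gen_set_ind H [set` S] [set x | exists n, x \in word_ball S n]); last first.
  by move=> s /word_ball_letter[sB _]; exists 1%N.
split; first by exists 0%N; rewrite inE.
- by move=> y z [m yB] [n zB]; exists (m + n)%N; exact: word_ballM.
- by move=> y [n yB]; exists n; exact: word_ballV.
Qed.

Lemma word_in_ball m u v w : u \in word_ball S m -> v \in word_ball S m ->
  word u v w \in word_ball S (m * size w).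
Proof.
move=> uB vB; elim: w => [|c w IH]; first by rewrite muln0 /= inE.
by rewrite /= mulnS; apply: word_ballM => //; case: c.
Qed.

Lemma growth_free m u v : u \in word_ball S m -> v \in word_ball S m ->
    (forall w w', size w = size w' -> word u v w = word u v w' -> w = w') ->
  forall n, (2 ^ n <= growth S (m * n))%N.
Proof.
move=> uB vB free n; pose W := [seq word u v t | t : n.-tuple bool].
have W_uniq : uniq W.
  rewrite map_inj_uniq ?enum_uniq // => t t' E.
  by apply/val_inj/free => //; rewrite !size_tuple.
have W_size : size W = (2 ^ n)%N by rewrite size_map -cardE card_tuple card_bool.
rewrite -W_size /growth; apply: uniq_leq_size => // x /mapP[t _ ->].
by rewrite -{2}(size_tuple t); exact: word_in_ball.
Qed.

End Balls.

(** If u and v lie in the ball of radius m, the ball of radius m n contains 2^n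
    words in u and v, so the growth rate is at least 2^(1/m) > 1. *)
Lemma free_not_subexponential (R : realType) (H : groupType) (u v : H) :
    (forall w w', size w = size w' -> word u v w = word u v w' -> w = w') ->
  ~ subexponential_growth R H.
Proof.
move=> free [S [genS lim1]].
have inball x : exists n, x \in word_ball S n.
  by apply: gen_set_word_ball; rewrite genS.
have [m1 uB] := inball u; have [m2 vB] := inball v.
pose m := (m1 + m2).+1.
have {}uB : u \in word_ball S m by apply: (fsubsetP (word_ball_le _ _)) uB; lia.
have {}vB : v \in word_ball S m by apply: (fsubsetP (word_ball_le _ _)) vB; lia.
pose q : R := (2 `^ m%:R^-1)%R.
have q1 : (1 < q)%R.
  have : (1 `^ m%:R^-1 < q)%R.
    by apply: gt0_ltr_powR; rewrite ?invr_gt0 ?nnegrE ?ltr0n //; lra.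
  by rewrite powR1.
have [N _ bnd] : \forall n \near \oo,
    ((growth S n)%:R `^ n%:R^-1 < q :> R)%R by exact: cvgr_lt lim1 _ q1.
have /bnd/= : (N <= m * N.+1)%N by nia.
apply/negP; rewrite -leNgt.
have -> : q = ((2 ^+ N.+1) `^ (m * N.+1)%:R^-1)%R.
  rewrite -powR_mulrn // -powRrM; congr (_ `^ _)%R.
  by rewrite natrM invfM mulrCA mulfV ?pnatr_eq0 // mulr1.
rewrite ge0_ler_powR ?invr_ge0 ?nnegrE ?exprn_ge0 ?ler0n //.
by rewrite -natrX ler_nat; exact: (growth_free uB vB free).
Qed.

(** * Subquotients *)

(** Such a relation is the graph of a morphism onto a group of tree
    automorphisms, defined on a subgroup of H; a relation avoids forming the
    subgroup as a type. *)
Definition subquotient_rel (H : groupType) (rel : H -> treeAut -> Prop) : Prop :=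
  [/\ rel 1 1,
      forall x y g h, rel x g -> rel y h -> rel (x * y) (g * h),
      forall x g, rel x g -> rel x^-1 g^-1
    & forall g, rel 1 g -> g = 1].

(** M is then a quotient of a subgroup of H. *)
Definition subquotient (H : groupType) (M : set treeAut) : Prop :=
  exists2 rel, @subquotient_rel H rel & M = [set g | exists x, rel x g].

(** Some subquotient contains a and b, hence the whole group they generate. *)
Definition involves_basilica (H : groupType) : Prop :=
  exists M, [/\ subquotient H M, M a & M b].

Lemma multiplicative1 (H K : groupType) (f : {multiplicative H -> K}) : f 1 = 1.
Proof. by apply: (mulgI (f 1)); rewrite -gmulfM !mulg1. Qed.

Lemma multiplicativeV (H K : groupType) (f : {multiplicative H -> K}) x : f x^-1 = (f x)^-1.
Proof. by apply/esym/mulg1_eq; rewrite -gmulfM mulgV multiplicative1. Qed.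

Section SubquotientTransfer.
Variables H K : groupType.

Lemma subquotient_group M : subquotient H M -> is_subgroup M.
Proof.
move=> [rel [r1 rM rV rinj] ->]; split; first by exists 1.
- by move=> g h [x xg] [y yh]; exists (x * y); exact: rM.
- by move=> g [x xg]; exists x^-1; exact: rV.
Qed.

Lemma involves_subgroup (i : {multiplicative H -> K}) :
  injective i -> involves_basilica H -> involves_basilica K.
Proof.
move=> i_inj [M [[rel [r1 rM rV rinj] ->] Ma Mb]].
exists [set g | exists x, rel x g]; split=> //.
exists (fun y g => exists2 x, y = i x & rel x g).
  split.
  - by exists 1; rewrite ?multiplicative1.
  - move=> _ _ g h [x -> xg] [y -> yh].
    by exists (x * y); [rewrite gmulfM|exact: rM].
  - by move=> _ g [x -> xg]; exists x^-1; [rewrite multiplicativeV|exact: rV].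
  - by move=> g [x]; rewrite -(multiplicative1 i) => /i_inj <-; exact: rinj.
apply/seteqP; split=> g [x]; first by move=> xg; exists (i x), x.
by move=> [y _ yg]; exists y.
Qed.

Lemma involves_quotient (p : {multiplicative K -> H}) :
  range p = setT -> involves_basilica H -> involves_basilica K.
Proof.
move=> p_surj [M [[rel [r1 rM rV rinj] ->] Ma Mb]].
exists [set g | exists x, rel x g]; split=> //.
exists (fun y => rel (p y)).
  split.
  - by rewrite multiplicative1.
  - by move=> x y g h; rewrite gmulfM; exact: rM.
  - by move=> x g; rewrite multiplicativeV; exact: rV.
  - by move=> g; rewrite multiplicative1; exact: rinj.
apply/seteqP; split=> g [x xg]; last by exists (p x).
have : range p x by rewrite p_surj.
by case=> y _ yx; exists y; rewrite yx.
Qed.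

End SubquotientTransfer.

(** * Normal subgroups involve the whole group *)

Lemma G_J x y : G x -> G y -> G (x ^ y).
Proof.
by move=> Gx Gy; rewrite conjgE; apply: gen_setM; [exact: gen_setV|exact: gen_setM].
Qed.

Section Portraits.
Implicit Types g h x y : treeAut.

Lemma portrait_conj g h x y :
  portrait false g h ^ portrait false x y = portrait false (g ^ x) (h ^ y).
Proof. by rewrite conjgE portraitV !portraitM. Qed.

Lemma portrait_conj_swap g h x y :
  portrait false g h ^ portrait true x y = portrait false (h ^ y) (g ^ x).
Proof. by rewrite conjgE portraitV !portraitM. Qed.

Lemma portrait_comm g h x y :
  [~ portrait false g h, portrait false x y] = portrait false [~ g, x] [~ h, y].
Proof. by rewrite commgEl portrait_conj portraitV portraitM. Qed.

(** Conjugation by an element that exchanges the two subtrees moves the second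
    coordinate of the inner commutator only, and the outer one kills it. *)
Lemma portrait_comm_swap x y g h :
  [~ [~ portrait true x y, portrait false g 1], portrait false h 1] =
  portrait false [~ g, h] 1.
Proof.
rewrite (commgEr (portrait true x y)) portraitV portrait_conj_swap portraitM.
by rewrite invg1 conj1g mul1g mulg1 portrait_comm commg1.
Qed.

End Portraits.

Lemma bbP : b * b = portrait false a a.
Proof. by rewrite {1 2}bP portraitM mul1g mulg1. Qed.

Lemma abP : a ^ b = portrait false (b ^ a) 1.
Proof. by rewrite {1}aP {2}bP portrait_conj_swap conj1g. Qed.

Lemma abVP : a ^ b^-1 = portrait false b 1.
Proof. by rewrite {1}aP bVP portrait_conj_swap conjg1 conj1g. Qed.

Lemma baP : b ^ a = portrait true b (b^-1 * a).
Proof.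
transitivity (portrait false 1 b^-1 * (portrait true 1 a * portrait false 1 b)).
  by rewrite -aVP -bP -aP.
by rewrite !portraitM /= !mul1g ?mulg1.
Qed.

Lemma commabP : [~ a, b] = portrait false (b ^ a) b^-1.
Proof. by rewrite commgEl abP aVP portraitM mul1g mulg1. Qed.

Lemma comm_bb_a : [~ b * b, a] = [~ b, a] ^ b * [~ b, a].
Proof. by rewrite !commgEl !conjgE !invgM !mulgA !(mulgK, mulgVK). Qed.

Definition pair_at (i : bool) g h :=
  if i then portrait false h g else portrait false g h.

(** The sections at the vertex i of those elements of M that fix i. *)
Definition section_set i (M : set treeAut) : set treeAut :=
  [set g | exists h, M (pair_at i g h)].

Lemma pair_at1 i : pair_at i 1 1 = 1.
Proof. by case: i; exact: portrait1. Qed.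
Lemma pair_atM i g h g' h' :
  pair_at i g h * pair_at i g' h' = pair_at i (g * g') (h * h').
Proof. by case: i; rewrite portraitM. Qed.
Lemma pair_atV i g h : (pair_at i g h)^-1 = pair_at i g^-1 h^-1.
Proof. by case: i; rewrite portraitV. Qed.
Lemma pair_atJ i g h x y : pair_at i g h ^ pair_at i x y = pair_at i (g ^ x) (h ^ y).
Proof. by case: i; rewrite portrait_conj. Qed.

(** The group is self-replicating: b b = (a, a), while a and its conjugate by
    b^-1 are (1, b) and (b, 1). *)
Lemma G_pair_at i g : G g -> exists h, G (pair_at i g h).
Proof.
apply: (@gen_set_ind _ _ (section_set i G)) g.
  split.
  - by exists 1; rewrite pair_at1; exact: gen_set1.
  - move=> x y [x' Gx] [y' Gy]; exists (x' * y').
    by rewrite -pair_atM; exact: gen_setM.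
  - by move=> x [x' Gx]; exists x'^-1; rewrite -pair_atV; exact: gen_setV.
have Gbb : G (portrait false a a) by rewrite -bbP; exact: gen_setM Gb Gb.
have Gb1 : G (portrait false b 1).
  by rewrite -abVP; apply: G_J Ga (gen_setV Gb).
have G1b : G (portrait false 1 b) by rewrite -aP; exact: Ga.
move=> _ [->|->]; first by exists a; case: i.
by exists 1; case: i.
Qed.

Definition normalized (M : set treeAut) : Prop :=
  is_subgroup M /\ forall g x, M g -> G x -> M (g ^ x).

Lemma section_set_normalized i M : normalized M -> normalized (section_set i M).
Proof.
move=> [[M1 MM MV] MJ]; split; first split.
- by exists 1; rewrite pair_at1.
- by move=> x y [x' Mx] [y' My]; exists (x' * y'); rewrite -pair_atM; exact: MM.
- by move=> x [x' Mx]; exists x'^-1; rewrite -pair_atV; exact: MV.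
move=> g x [g' Mg] /(@G_pair_at i)[x' Gx].
by exists (g' ^ x'); rewrite -pair_atJ; exact: MJ.
Qed.

Section NormalSubquotients.
Variable H : groupType.

(** Taking sections at a fixed vertex is a morphism on its stabilizer. *)
Lemma subquotient_section i M : subquotient H M -> subquotient H (section_set i M).
Proof.
move=> [rel [r1 rM rV rinj] ->].
exists (fun x g => exists h, rel x (pair_at i g h)).
  split.
  - by exists 1; rewrite pair_at1.
  - move=> x y g h [g' xg] [h' yh]; exists (g' * h').
    by rewrite -pair_atM; exact: rM.
  - by move=> x g [g' xg]; exists g'^-1; rewrite -pair_atV; exact: rV.
  - move=> g [h /rinj gh].
    have : pair_at i g h = pair_at i 1 1 by rewrite gh pair_at1.
    by case: (i) => /portrait_inj[].
by apply/seteqP; split=> g [x [h E]]; exists h, x.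
Qed.

Definition normal_subquotient M := normalized M /\ subquotient H M.

Lemma normal_subquotient_section i M :
  normal_subquotient M -> normal_subquotient (section_set i M).
Proof.
by move=> [nM qM]; split;
  [exact: section_set_normalized|exact: subquotient_section].
Qed.

(** Passing to sections along a moved vertex, one reaches an element that moves
    a vertex of the first level. *)
Lemma normal_subquotient_swap M g : normal_subquotient M -> M g -> g <> 1 ->
  exists M', normal_subquotient M' /\ exists x y, M' (portrait true x y).
Proof.
move=> nM Mg g1.
have [v gv] : exists v, g v <> v.
  by apply/existsNP => gid; apply: g1; apply: treeAutP.
elim: v => [|i w IH] in M g nM Mg gv {g1} *.
  by case: gv; have /asboolP[] := aut_funP g.
have [[] [x [y gE]]] := ex_portrait g.
  by exists M; split=> //; exists x, y; rewrite -gE.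
apply: (IH (section_set i M) (if i then y else x)).
- exact: normal_subquotient_section.
- by exists (if i then x else y); case: (i); rewrite /pair_at -gE.
- by apply: contra_not gv; rewrite gE /= addbF; case: (i) => ->.
Qed.

(** With b the group M contains (a, a) = b b and the commutator of b and a, whose
    section at 0 is conjugate to b^-1. *)
Lemma involves_of_b M : normal_subquotient M -> M b -> involves_basilica H.
Proof.
move=> nM Mb; have [[[_ MM MV] MJ] _] := nM.
have [[[_ _ SV] SJ] qS] := normal_subquotient_section false nM.
exists (section_set false M); split=> //.
  by exists a; rewrite /pair_at -bbP; exact: MM.
have : section_set false M (b^-1 ^ a).
  exists b; rewrite /pair_at.
  have -> : portrait false (b^-1 ^ a) b = b^-1 * b ^ a.
    by rewrite baP bVP portraitM mul1g conjgE.
  by apply: MM; [exact: MV|exact: MJ Mb Ga].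
move=> /SV/SJ/(_ (gen_setV Ga)).
by rewrite -conjVg invgK conjgK.
Qed.

(** Let c = [a, b] = (b ^ a, b^-1).  Both (c, 1) and ((1, c), 1) belong to G, so
    by [portrait_comm_swap] M contains ([c, (1, c)], 1) = ((1, [b^-1, c]), 1).
    Successive sections then give [b^-1, c]; its inverse conjugated by b is
    [b, c] = ((b b) ^ a, ..), next b b = (a, a), then a = (1, b), and finally b,
    where [involves_of_b] applies. *)
Lemma involves_of_swap M x y : normal_subquotient M -> M (portrait true x y) ->
  involves_basilica H.
Proof.
move=> nM Mg; have [[[_ MM MV] MJ] _] := nM.
have MR g h : M g -> G h -> M [~ g, h].
  by move=> Mh Gh; rewrite commgEl; apply: MM; [exact: MV|exact: MJ].
have Gba : G (portrait false [~ b, a] 1).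
  have -> : portrait false [~ b, a] 1 = [~ a, b * b] ^ b^-1.
    rewrite bbP {2}aP portrait_comm comm1g bVP portrait_conj_swap.
    by rewrite conj1g conjg1.
  apply: G_J (gen_setV Gb); rewrite commgEl; apply: gen_setM.
    exact: gen_setV Ga.
  by apply: G_J Ga _; exact: gen_setM Gb Gb.
have Gc : G (portrait false [~ a, b] 1).
  by have := gen_setV Gba; rewrite portraitV /= invg1 invgR.
have Gd : G (portrait false (portrait false 1 [~ a, b]) 1).
  have -> : portrait false 1 [~ a, b] = [~ b, a] ^ b * [~ b, a].
    by rewrite -comm_bb_a bbP {4}aP portrait_comm commg1.
  have -> : portrait false ([~ b, a] ^ b * [~ b, a]) 1 =
      portrait false [~ b, a] 1 ^ (a ^ b^-1) * portrait false [~ b, a] 1.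
    by rewrite abVP portrait_conj portraitM conj1g mulg1.
  by apply: gen_setM => //; apply: G_J => //; apply: G_J Ga (gen_setV Gb).
have /normal_subquotient_section-/(_ false)nM1 := nM.
have M1 : section_set false M (portrait false 1 [~ b^-1, [~ a, b]]).
  exists 1; rewrite /pair_at.
  have -> : portrait false 1 [~ b^-1, [~ a, b]] =
            [~ [~ a, b], portrait false 1 [~ a, b]].
    by rewrite {2}commabP portrait_comm commg1.
  have <- := portrait_comm_swap x y [~ a, b] (portrait false 1 [~ a, b]).
  by apply: (MR) => //; exact: MR.
have /normal_subquotient_section-/(_ true)nM2 := nM1.
have {}M1 : section_set true (section_set false M) [~ b^-1, [~ a, b]] by exists 1.
move: nM2 M1; set M2 := section_set true _ => nM2 M2r.
have {M2r} : M2 (portrait false ((b * b) ^ a) (b^-1 ^ a * b^-1)).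
  have -> : portrait false ((b * b) ^ a) (b^-1 ^ a * b^-1) = [~ b, [~ a, b]].
    have -> : [~ b, [~ a, b]] = (portrait false (b ^ a) b^-1)^-1 ^
        portrait true 1 a * portrait false (b ^ a) b^-1.
      by rewrite -bP -commabP -commgEr.
    rewrite portraitV portrait_conj_swap portraitM /= invgK conjg1.
    by rewrite conjMg conjVg.
  have -> : [~ b, [~ a, b]] = ([~ b^-1, [~ a, b]] ^ b)^-1.
    by rewrite !commgEl !conjgE !invgM !invgK !mulgA mulgVK.
  by case: nM2 => -[[_ _ M2V] M2J] _; apply: M2V; exact: M2J M2r Gb.
have /normal_subquotient_section-/(_ false)nM3 := nM2.
move=> M2r; have {M2r} : section_set false M2 ((b * b) ^ a) by eexists; exact: M2r.
move: nM3; set M3 := section_set false M2 => nM3 M3r.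
have {M3r} : M3 (portrait false a a).
  by rewrite -bbP -[b * b](conjgK a); apply: nM3.1.2 => //; exact: gen_setV Ga.
have /normal_subquotient_section-/(_ false)nM4 := nM3.
move=> M3r; have {M3r} M4a : section_set false M3 a by exists a.
have /normal_subquotient_section-/(_ true)nM5 := nM4.
by apply: involves_of_b nM5 _; exists 1; rewrite /pair_at -aP.
Qed.

Lemma involves_of_normal M g :
  normal_subquotient M -> M g -> g <> 1 -> involves_basilica H.
Proof.
move=> nM Mg g1.
have [M' [nM' [x [y M'xy]]]] := normal_subquotient_swap nM Mg g1.
exact: involves_of_swap M'xy.
Qed.

End NormalSubquotients.

(** * The group is not subexponentially amenable *)

(** The part of a subquotient of E coming from N is normal in G.  If it is
    trivial the subquotient factors through Q. *)
Lemma involves_extension (N E Q : groupType)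
    (i : {multiplicative N -> E}) (p : {multiplicative E -> Q}) :
    injective i -> range i = [set x | p x = 1] ->
  involves_basilica E -> involves_basilica N \/ involves_basilica Q.
Proof.
move=> i_inj ker_p [M [qM Ma Mb]].
have Msub := subquotient_group qM.
case: qM => rel [r1 rM rV rinj] ME.
pose K := [set g | exists n, rel (i n) g].
have [[g Kg g1]|K1] := pselect (exists2 g, K g & g <> 1); [left|right].
  apply: (involves_of_normal _ Kg g1); split; last first.
    exists (fun n => rel (i n)) => //; split.
    - by rewrite multiplicative1.
    - by move=> x y h k; rewrite gmulfM; exact: rM.
    - by move=> x h; rewrite multiplicativeV; exact: rV.
    - by move=> h; rewrite multiplicative1; exact: rinj.
  split; first split.
  - by exists 1; rewrite multiplicative1.
  - by move=> h k [x xh] [y yk]; exists (x * y); rewrite gmulfM; exact: rM.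
  - by move=> h [x xh]; exists x^-1; rewrite multiplicativeV; exact: rV.
  move=> h x [n nh] Gx.
  have : M x by apply: (gen_set_ind Msub) Gx => _ [->|->].
  rewrite ME => -[e ex].
  have : range i (i n ^ e).
    have pn : p (i n) = 1 by have : range i (i n) by []; rewrite ker_p.
    by rewrite ker_p /= conjgE !gmulfM pn mul1g -gmulfM mulVg multiplicative1.
  by case=> m _ mE; exists m; rewrite mE conjgE; apply: (rM); [exact: rV|exact: rM].
exists [set g | exists q, exists2 e, p e = q & rel e g]; split; last first.
- by move: Mb; rewrite ME => -[e eb]; exists (p e), e.
- by move: Ma; rewrite ME => -[e ea]; exists (p e), e.
exists (fun q g => exists2 e, p e = q & rel e g) => //; split.
- by exists 1; rewrite ?multiplicative1.
- move=> _ _ g h [x <- xg] [y <- yh].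
  by exists (x * y); [rewrite gmulfM|exact: rM].
- by move=> _ g [x <- xg]; exists x^-1; [rewrite multiplicativeV|exact: rV].
- move=> g [e pe eg]; apply: contrapT => g1; apply: K1; exists g => //.
  have : range i e by rewrite ker_p.
  by case=> n _ ne; exists n; rewrite ne.
Qed.

Section DirectLimit.
Variables (I : Type) (le : I -> I -> Prop) (F : I -> groupType).
Variables (f : forall i j, le i j -> {multiplicative F i -> F j}).
Variables (L : groupType) (c : forall i, {multiplicative F i -> L}).
Hypothesis L_lim : is_direct_limit f c.

Let image_union : set L := [set x | exists i y, c i y = x].

Lemma image_union_common x y : image_union x -> image_union y ->
  exists k x' y', c k x' = x /\ c k y' = y.
Proof.
have [[[_ _ _ dir] _ _] coc _] := L_lim.
move=> [i [x' <-]] [j [y' <-]]; have [k ik jk] := dir i j.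
by exists k, (f ik x'), (f jk y'); rewrite !coc.
Qed.

Lemma image_union_subgroup : is_subgroup image_union.
Proof.
have [[[[i0] _ _ _] _ _] _ _] := L_lim; split.
- by exists i0, 1; rewrite multiplicative1.
- move=> x y Ix Iy; have [k [x' [y' [<- <-]]]] := image_union_common Ix Iy.
  by exists k, (x' * y'); rewrite gmulfM.
- by move=> _ [i [x <-]]; exists i, x^-1; rewrite multiplicativeV.
Qed.

(** The union U of the images satisfies the cocone conditions, so there is a
    morphism from L to U; by uniqueness its composite with the inclusion of U
    is the identity of L. *)
Lemma direct_limit_union x : image_union x.
Proof.
have [_ coc univ] := L_lim.
have inU i y : `[< gen_set image_union (c i y) >].
  by apply/asboolP; apply: gen_set_gen; exists i, y.
pose d i y : gen_group image_union := GenGroup (inU i y).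
have dM i : {morph d i : y z / y * z}.
  by move=> y z; apply: val_inj; rewrite valM /= gmulfM.
pose d' i : {multiplicative F i -> gen_group image_union} :=
  HB.pack (d i) (isMultiplicative.Build _ _ (d i) (dM i)).
have d'coc : is_cocone f d'.
  by move=> i j ij y; apply: val_inj => /=; exact: coc.
have [u ud _] := univ _ d' d'coc.
have [w _ w_uniq] := univ _ c coc.
pose vu z : L := val (u z).
have vuM : {morph vu : y z / y * z} by move=> y z; rewrite /vu gmulfM valM.
pose vu' : {multiplicative L -> L} :=
  HB.pack vu (isMultiplicative.Build _ _ vu vuM).
have vuE : vu' =1 w by apply: w_uniq => i y /=; rewrite /vu ud.
have idE : (idfun : {multiplicative L -> L}) =1 w by apply: w_uniq.
have -> : x = val (u x) by apply: etrans (idE x) (esym (vuE x)).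
apply: (gen_set_ind image_union_subgroup (@subset_refl _ image_union)).
exact: (asboolW (gen_valP _)).
Qed.

(** Preimages of a and b come from a common term of the system, because it is
    directed. *)
Lemma involves_direct_limit : involves_basilica L -> exists i, involves_basilica (F i).
Proof.
move=> [M [[rel [r1 rM rV rinj] ->] [u ua] [v vb]]].
have [k [u' [v' [uE vE]]]] :=
  image_union_common (direct_limit_union u) (direct_limit_union v).
exists k, [set g | exists x, rel (c k x) g]; split.
- exists (fun x => rel (c k x)) => //; split.
  + by rewrite multiplicative1.
  + by move=> x y g h; rewrite gmulfM; exact: rM.
  + by move=> x g; rewrite multiplicativeV; exact: rV.
  + by move=> g; rewrite multiplicative1; exact: rinj.
- by exists u'; rewrite uE.
- by exists v'; rewrite vE.
Qed.

End DirectLimit.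

Lemma subexponential_not_involves (R : realType) (H : groupType) :
  subexponential_growth R H -> ~ involves_basilica H.
Proof.
move=> subexp [M [[rel [r1 rM rV rinj] ->] [u ua] [v vb]]].
have rel_word w : rel (word u v w) (word a b w).
  by elim: w => //= c w IH; apply: rM => //; case: c.
apply: (free_not_subexponential (u := u) (v := v)) subexp => w w' sz E.
apply: word_inj => //; apply/divg1_eq/rinj.
by rewrite -(mulgV (word u v w)) {2}E; apply: rM => //; exact: rV.
Qed.

Theorem SG_not_involves (R : realType) (H : groupType) :
  SG R H -> ~ involves_basilica H.
Proof.
elim=> {H}.
- by move=> H; exact: subexponential_not_involves.
- by move=> H K i i_inj _ IH /(involves_subgroup i_inj).
- by move=> H Q p p_surj _ IH /(involves_quotient p_surj).
- move=> N E Q i p i_inj ker_p _ _ IHN _ IHQ.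
  by case/(involves_extension i_inj ker_p).
- by move=> I le F f L c lim _ IH /(involves_direct_limit lim)[i /IH].
Qed.

Lemma basilica_involves : involves_basilica basilica.
Proof.
exists G; split; [|exact: Ga|exact: Gb].
exists (fun x g => val x = g).
  split=> [|x y _ _ <- <-|x _ <-|_ <-]; first exact: val1.
  - exact: valM.
  - exact: gmulfV.
  - exact: val1.
apply/seteqP; split=> g.
  by move=> Gg; exists (GenGroup (asboolT Gg)).
by move=> [x <-]; exact: (asboolW (gen_valP x)).
Qed.

Lemma basilica_not_SG (R : realType) : ~ SG R basilica.
Proof. by move=> /SG_not_involves; apply; exact: basilica_involves. Qed.

(** * Self-similar potentials *)

Local Open Scope ring_scope.

Definition portrait_data g : {t : bool * (treeAut * treeAut) |
  g = portrait t.1 t.2.1 t.2.2}.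
Proof.
by apply: cid; have [s [x [y ->]]] := ex_portrait g; exists (s, (x, y)).
Qed.

Definition decomp g := sval (portrait_data g).

Lemma decompK g : portrait (decomp g).1 (decomp g).2.1 (decomp g).2.2 = g.
Proof. by rewrite /decomp; case: (portrait_data g). Qed.

Lemma decomp_portrait s x y : decomp (portrait s x y) = (s, (x, y)).
Proof.
have := decompK (portrait s x y).
by case: (decomp _) => s' [x' y'] /= /portrait_inj[-> -> ->].
Qed.

(** The set of elements with both sections in G is a subgroup that contains a
    and b. *)
Lemma G_sections g : G g -> G (decomp g).2.1 /\ G (decomp g).2.2.
Proof.
pose K := [set g | exists s x y, [/\ g = portrait s x y, G x & G y]].
suff GK : G `<=` K.
  by move=> /GK[s [x [y [-> Gx Gy]]]]; rewrite decomp_portrait.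
apply: gen_set_ind => [|_ [->|->]]; last 2 first.
- by exists false, 1%g, b; split; [exact: aP|exact: gen_set1|exact: Gb].
- by exists true, 1%g, a; split; [exact: bP|exact: gen_set1|exact: Ga].
split.
- exists false, 1%g, 1%g.
  by split; [rewrite portrait1|exact: gen_set1|exact: gen_set1].
- move=> _ _ [s [x [y [-> Gx Gy]]]] [t [x' [y' [-> Gx' Gy']]]].
  rewrite portraitM; do 3! eexists; split; first by [].
    by apply: gen_setM => //; case: (s).
  by apply: gen_setM => //; case: (s).
- move=> _ [s [x [y [-> Gx Gy]]]].
  rewrite portraitV; do 3! eexists; split; first by [].
    by case: (s); exact: gen_setV.
  by case: (s); exact: gen_setV.
Qed.

Definition letter (x : treeAut) : Prop := [\/ x = a, x = a^-1%g, x = b | x = b^-1%g].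

Lemma letterV x : letter x -> letter x^-1%g.
Proof.
by case=> ->; rewrite ?invgK; [apply: Or42|apply: Or41|apply: Or44|apply: Or43].
Qed.

Section RightMultiplication.
Variables (s : bool) (x y : treeAut).
Local Open Scope group_scope.

Lemma portrait_mul_a : portrait s x y * a =
  portrait s (if s then x * b else x) (if s then y else y * b).
Proof. by rewrite [X in _ * X]aP portraitM addbF; case: s; rewrite mulg1. Qed.

Lemma portrait_mul_aV : portrait s x y * a^-1 =
  portrait s (if s then x * b^-1 else x) (if s then y else y * b^-1).
Proof. by rewrite aVP portraitM addbF; case: s; rewrite mulg1. Qed.

Lemma portrait_mul_b : portrait s x y * b =
  portrait (~~ s) (if s then x * a else x) (if s then y else y * a).
Proof. by rewrite [X in _ * X]bP portraitM addbT; case: s; rewrite mulg1. Qed.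

Lemma portrait_mul_bV : portrait s x y * b^-1 =
  portrait (~~ s) (if s then x else x * a^-1) (if s then y * a^-1 else y).
Proof. by rewrite bVP portraitM addbT; case: s; rewrite mulg1. Qed.

Lemma portrait_mul_letter z : letter z -> exists s' x' y',
  portrait s x y * z = portrait s' x' y' /\
  (x' = x /\ (exists2 u, letter u & y' = y * u) \/
   y' = y /\ (exists2 u, letter u & x' = x * u)).
Proof.
have [la laV lb lbV] : [/\ letter a, letter a^-1, letter b & letter b^-1].
  by split; [apply: Or41|apply: Or42|apply: Or43|apply: Or44].
case=> ->; rewrite ?portrait_mul_a ?portrait_mul_aV ?portrait_mul_b
  ?portrait_mul_bV; do 3! eexists; (split; first by []); case: s;
  by [left; split=> //; eexists; [|reflexivity]
     |right; split=> //; eexists; [|reflexivity]].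
Qed.

End RightMultiplication.

Section Potentials.
Variable R : realType.
Implicit Types (Phi : treeAut -> R) (l C : R).

(** The weights below satisfy 2 (weight_a + weight_b) = 1, and this value of r is
    the one for which the walk reproduces itself on coordinates. *)
Definition sqrt_half : R := Num.sqrt 2^-1.
Local Notation r := sqrt_half.

Lemma sqrt_half_sqr : r * r = 2^-1.
Proof. by rewrite -expr2 sqr_sqrtr ?invr_ge0. Qed.

Lemma sqrt_half_bounds : 2^-1 < r /\ r < 1.
Proof.
have r0 : 0 <= r by exact: sqrtr_ge0.
by have := sqrt_half_sqr; split; nra.
Qed.

Definition weight_a : R := r - 2^-1.
Definition weight_b : R := 1 - r.
Local Notation alpha := weight_a.
Local Notation beta := weight_b.

(** The mean of Phi after one step of the walk started at g. *)
Definition average Phi g : R :=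
  alpha * (Phi (g * a)%g + Phi (g * a^-1)%g) +
  beta * (Phi (g * b)%g + Phi (g * b^-1)%g).

Definition letter_lipschitz Phi C : Prop :=
  forall g x, letter x -> Phi g <= Phi (g * x)%g + C.

Definition exp_summable Phi K : Prop := forall A : {fset treeAut},
  (forall x, x \in A -> G x) -> \sum_(x <- A) expR (- Phi x) <= K.

(** The Lipschitz condition serves to compare a lifted potential with the sum of
    the potentials of the two coordinates. *)
Definition potential l Phi : Prop :=
  [/\ forall g, average Phi g <= Phi g + l,
      exists C, letter_lipschitz Phi C
    & exists K, exp_summable Phi K].

(** The coordinate that a multiplies by b is evaluated directly.  The other one
    is in the middle of an excursion at whose end it will be z or z a^-1 with
    equal probability, and it is evaluated by the mean of these two outcomes. *)
Definition lift_potential Phi g : R :=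
  let: (s, (x, y)) := decomp g in
  let rest z := (Phi z + Phi (z * a^-1)%g) / 2 in
  if s then Phi x + rest y else rest x + Phi y.

(** Let s be such that x is the coordinate that a multiplies by b.  A step a or
    a^-1 contributes x b, x b^-1 with weight alpha each, and a flip contributes
    x a, x a^-1 with weight beta / 2 each and x with weight beta.  As
    alpha = r beta and beta / 2 = r alpha, this is r times a step of the walk
    plus beta times staying at x, where r + beta = 1.  So x gains at most r l,
    and the mean evaluation of y is preserved. *)
Lemma lift_average Phi l :
  (forall g, average Phi g <= Phi g + l) ->
  forall g, average (lift_potential Phi) g <= lift_potential Phi g + r * l.
Proof.
move=> drift g; rewrite -(decompK g); case: (decomp g) => s [x y] /=.
have step z : alpha * (Phi (z * b)%g + Phi (z * b^-1)%g) +
    beta / 2 * (Phi (z * a)%g + Phi (z * a^-1)%g) <= r * Phi z + r * l.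
  rewrite -mulrDr; have [r_gt _] := sqrt_half_bounds.
  have := ler_wpM2l (ltW (lt_trans _ r_gt)) (drift z); rewrite invr_gt0 ltr0n.
  move=> /(_ isT); apply: le_trans.
  rewrite /average [leRHS]mulrDr !(mulrA r).
  have -> : r * alpha = beta / 2.
    by rewrite /alpha /beta mulrBr sqrt_half_sqr; field.
  have -> : r * beta = alpha by rewrite /alpha /beta mulrBr sqrt_half_sqr mulr1.
  by rewrite addrC.
rewrite /average !(portrait_mul_a, portrait_mul_aV, portrait_mul_b, portrait_mul_bV).
rewrite /lift_potential !decomp_portrait; case: s => /=; rewrite ?mulgK ?mulgVK.
  by have := step x; rewrite /alpha /beta; lra.
by have := step y; rewrite /alpha /beta; lra.
Qed.

Lemma lift_bounds Phi C g : letter_lipschitz Phi C ->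
  Phi (decomp g).2.1 + Phi (decomp g).2.2 - C <= lift_potential Phi g
    <= Phi (decomp g).2.1 + Phi (decomp g).2.2 + C.
Proof.
move=> lip; rewrite /lift_potential.
case: (decomp g) => s [x y] /=.
have shift z : Phi z <= Phi (z * a^-1)%g + C /\ Phi (z * a^-1)%g <= Phi z + C.
  split; first by apply: lip; exact: Or42.
  by have := lip (z * a^-1)%g a (Or41 _ _ _ erefl); rewrite mulgVK.
have [x1 x2] := shift x; have [y1 y2] := shift y.
by case: s; lra.
Qed.

Lemma lift_lipschitz Phi C : letter_lipschitz Phi C ->
  letter_lipschitz (lift_potential Phi) (3 * C).
Proof.
move=> lip g z zl.
have [s' [x' [y' [gz moves]]]] :=
  portrait_mul_letter (decomp g).1 (decomp g).2.1 (decomp g).2.2 zl.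
move: gz; rewrite decompK => gz.
have /andP[_ ub] := lift_bounds g lip.
have /andP[lb _] := lift_bounds (g * z)%g lip.
move: lb; rewrite {1 2}gz decomp_portrait /= => lb.
case: moves => -[x'E y'E]; rewrite x'E in lb.
  by case: y'E lb => u /(lip (decomp g).2.2) ? -> lb; lra.
by case: y'E lb => u /(lip (decomp g).2.1) ? -> lb; lra.
Qed.

(** An element is determined by s and its two sections, and exp of minus the
    lifted potential is at most exp C times the product of the corresponding
    values for the sections, so the sum is at most 2 exp C times K^2. *)
Lemma lift_summable Phi C K : letter_lipschitz Phi C -> exp_summable Phi K ->
  exp_summable (lift_potential Phi) (2 * expR C * K ^+ 2).
Proof.
move=> lip sumK A AG.
pose H (t : bool * (treeAut * treeAut)) := expR (- Phi t.2.1) * expR (- Phi t.2.2).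
apply: (@le_trans _ _ (expR C * \sum_(x <- A) H (decomp x))).
  rewrite mulr_sumr; apply: ler_sum => g _.
  rewrite /H -!expRD ler_expR; have := lift_bounds g lip; lra.
rewrite [2 * _]mulrC -mulrA ler_pM2l ?expR_gt0 //.
pose A0 := [fset (decomp g).2.1 | g in A]%fset.
pose A1 := [fset (decomp g).2.2 | g in A]%fset.
have sum0 : \sum_(x <- A0) expR (- Phi x) <= K.
  by apply: sumK => x /imfsetP[g /AG/G_sections[Gx _] ->].
have sum1 : \sum_(x <- A1) expR (- Phi x) <= K.
  by apply: sumK => x /imfsetP[g /AG/G_sections[_ Gx] ->].
rewrite -(big_map decomp predT H).
pose B := [seq (s, t) | s <- [:: true; false], t <- [seq (x, y) | x <- A0, y <- A1]].
apply: (@le_trans _ _ (\sum_(t <- B) H t)).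
  apply: ler_sum_uniq => [t| |t /mapP[g gA ->]].
  - by apply: mulr_ge0; exact: expR_ge0.
  - rewrite map_inj_uniq ?fset_uniq // => g h gh.
    by rewrite -(decompK g) gh decompK.
  - apply/allpairsP; exists ((decomp g).1, (decomp g).2); split => /=.
    + by case: (decomp g).1.
    + apply/allpairsP; exists (decomp g).2; split => /=.
      * by apply/imfsetP; exists g.
      * by apply/imfsetP; exists g.
      * by case: (decomp g).2.
    + by case: (decomp g).
have pairs : \sum_(t <- [seq (x, y) | x <- A0, y <- A1])
    expR (- Phi t.1) * expR (- Phi t.2) <= K ^+ 2.
  rewrite big_allpairs /=; under eq_bigr do rewrite -mulr_sumr.
  rewrite -mulr_suml expr2.
  by apply: ler_pM => //; apply: sumr_ge0 => x _; exact: expR_ge0.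
rewrite /B big_allpairs big_cons big_seq1 [leRHS]mulr_natl mulr2n.
exact: (lerD pairs pairs).
Qed.

Lemma potential_lift Phi l : potential l Phi ->
  potential (r * l) (lift_potential Phi).
Proof.
move=> [drift [C lip] [K sumK]]; split; first exact: lift_average.
- by exists (3 * C); exact: lift_lipschitz.
- by exists (2 * expR C * K ^+ 2); exact: lift_summable.
Qed.

End Potentials.

(** * The word length as initial potential *)

Definition basilica_ball n : {fset treeAut} := word_ball [fset a; b]%fset n.

Lemma letter_ball x : letter x -> x \in basilica_ball 1.
Proof.
have [aB aVB] : a \in basilica_ball 1 /\ a^-1%g \in basilica_ball 1.
  by apply: word_ball_letter; rewrite !inE eqxx.
have [bB bVB] : b \in basilica_ball 1 /\ b^-1%g \in basilica_ball 1.
  by apply: word_ball_letter; rewrite !inE eqxx orbT.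
by case=> ->.
Qed.

Lemma G_ball x : G x -> exists n, x \in basilica_ball n.
Proof.
move=> Gx; apply: gen_set_word_ball; apply: (gen_set_ind _ _) Gx.
  exact: gen_set_subgroup.
by move=> _ [->|->]; apply: gen_set_gen; rewrite /= !inE eqxx ?orbT.
Qed.

Lemma card_ball n : (#|` basilica_ball n| <= 5 ^ n)%N.
Proof.
elim: n => [|n IH]; first by rewrite cardfs1.
rewrite expnS; apply: (@leq_trans (5 * #|` basilica_ball n|)); last by rewrite leq_mul2l IH.
pose L := [seq (x * y)%g | x <- basilica_ball n, y <- [:: 1; a; a^-1; b; b^-1]%g].
have -> : (5 * #|` basilica_ball n|)%N = size L by rewrite size_allpairs mulnC.
apply: uniq_leq_size; first exact: fset_uniq.
move=> x /word_ballSP[xB|[y yB [s]]].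
  by apply/allpairsP; exists (x, 1%g); rewrite mulg1 inE eqxx.
rewrite !inE => sab xE; apply/allpairsP.
by case: xE => ->; [exists (y, s)|exists (y, s^-1%g)]; split=> //=;
  case/orP: sab => /eqP ->; rewrite !inE eqxx ?orbT.
Qed.

(** The value 0 outside G keeps the one-step estimate valid everywhere. *)
Definition word_length (g : treeAut) : nat :=
  if pselect (exists n, g \in basilica_ball n) is left gB then ex_minn gB else 0.

Lemma word_length_le n g : g \in basilica_ball n -> (word_length g <= n)%N.
Proof.
move=> gB; rewrite /word_length; case: pselect => [gE|]; last by case; exists n.
by case: ex_minnP => m _; apply.
Qed.

Lemma word_lengthP n g : g \in basilica_ball n -> g \in basilica_ball (word_length g).
Proof.
move=> gB; rewrite /word_length; case: pselect => [gE|]; last by case; exists n.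
by case: ex_minnP.
Qed.

Lemma word_length_mul g x : letter x -> (word_length (g * x)%g <= (word_length g).+1)%N.
Proof.
move=> xl; have [[n gxB]|gxN] := pselect (exists n, (g * x)%g \in basilica_ball n); last first.
  by rewrite {1}/word_length; case: pselect.
have gB : g \in basilica_ball (n + 1).
  by rewrite -[g](mulgK x); apply: word_ballM => //; exact/letter_ball/letterV.
apply: word_length_le; rewrite -addn1; apply: word_ballM.
  exact: word_lengthP gB.
exact: letter_ball.
Qed.

Section Amenability.
Variable R : realType.

(** The factor 4 makes exp(- 4) small against the growth rate of the balls, which
    is at most 5: 5 exp(- 4) <= 1 / 2. *)
Definition length_potential (g : treeAut) : R := 4 * (word_length g)%:R.

Lemma sum_ball N :
  \sum_(x <- basilica_ball N) expR (- length_potential x) <= 2 - 2^-1 ^+ N.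
Proof.
pose F (x : treeAut) : R := expR (- length_potential x).
have F0 x : 0 <= F x by exact: expR_ge0.
have theta : 5 * expR (- 4) <= 2^-1 :> R.
  have e2 : 2 <= expR 1 :> R by have := expR_ge1Dx (1 : R); lra.
  have e16 : 16 <= expR 4 :> R.
    rewrite -[X in expR X]mulr1 expRM_natl (_ : 16 = 2 ^+ 4); last by ring.
    by rewrite lerXn2r ?nnegrE // expR_ge0.
  by rewrite expRN -(ler_pM2r (expR_gt0 4)) mulfVK ?gt_eqF ?expR_gt0 //; lra.
elim: N => [|N IH].
  rewrite big_seq_fset1 expr0; suff : F 1%g <= 1 by rewrite /F; lra.
  by rewrite -expR0 ler_expR oppr_le0 mulr_ge0.
apply: (@le_trans _ _ (\sum_(x <- basilica_ball N.+1)
    ((if x \in basilica_ball N then F x else 0) + expR (- 4) ^+ N.+1))).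
  rewrite [leLHS]big_seq [leRHS]big_seq; apply: ler_sum => x xB.
  case: ifPn => xN; first by rewrite lerDl exprn_ge0 // expR_ge0.
  have len : word_length x = N.+1.
    have := word_length_le xB; rewrite leq_eqVlt => /orP[/eqP//|lt].
    case/negP: xN; apply: (fsubsetP (word_ball_le _ _)) (word_lengthP xB).
    by rewrite -ltnS.
  by rewrite add0r /length_potential len -mulNr mulrC expRM_natl.
rewrite big_split /= -big_mkcond -big_filter; apply: (@le_trans _ _
  ((2 - 2^-1 ^+ N) + 2^-1 ^+ N.+1)); last first.
  by rewrite exprS; lra.
apply: lerD.
  apply: le_trans IH; apply: ler_sum_uniq => // [|x].
    by rewrite filter_uniq ?fset_uniq.
  by rewrite mem_filter => /andP[].
rewrite big_const_seq count_predT iter_addr_0 -[leLHS]mulr_natl.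
apply: (@le_trans _ _ ((5 * expR (-4)) ^+ N.+1)).
  rewrite exprMn ler_wpM2r ?exprn_ge0 ?expR_ge0 //.
  by rewrite -natrX ler_nat card_ball.
by rewrite lerXn2r ?nnegrE ?invr_ge0 // mulr_ge0 ?expR_ge0.
Qed.

Lemma length_potentialP : potential 4 length_potential.
Proof.
have step g x : letter x ->
    length_potential (g * x)%g <= length_potential g + 4.
  move=> /(word_length_mul g); rewrite -(ler_nat R) -natr1 /length_potential; lra.
have [r_gt r_lt] := sqrt_half_bounds R.
split.
- move=> g.
  have a0 : 0 <= weight_a R by rewrite subr_ge0 ltW.
  have b0 : 0 <= weight_b R by rewrite subr_ge0 ltW.
  have [s1 s2 s3 s4] : [/\ length_potential (g * a)%g <= length_potential g + 4,
    length_potential (g * a^-1)%g <= length_potential g + 4,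
    length_potential (g * b)%g <= length_potential g + 4 &
    length_potential (g * b^-1)%g <= length_potential g + 4].
    by split; apply: step; [exact: Or41|exact: Or42|exact: Or43|exact: Or44].
  apply: (@le_trans _ _ (2 * (weight_a R + weight_b R) * (length_potential g + 4))).
    rewrite /average.
    have := ler_wpM2l a0 (lerD s1 s2); have := ler_wpM2l b0 (lerD s3 s4); lra.
  have -> : 2 * (weight_a R + weight_b R) = 1 by rewrite /weight_a /weight_b; field.
  by rewrite mul1r.
- by exists 4 => g x /letterV xl; have := step (g * x)%g _ xl; rewrite mulgK.
- exists 2 => A AG.
  have [N AN] : exists N, {subset enum_fset A <= basilica_ball N}.
    elim: (enum_fset A) (AG : forall x, x \in enum_fset A -> G x) => [|x s IH] sG.
      by exists 0%N.
    have [|N sN] := IH; first by move=> y ys; apply: sG; rewrite inE ys orbT.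
    have [n xn] := G_ball (sG x (mem_head _ _)).
    exists (n + N)%N => y; rewrite inE => /orP[/eqP ->|/sN].
      by apply: (fsubsetP (word_ball_le _ _)) xn; rewrite leq_addr.
    by apply: (fsubsetP (word_ball_le _ _)); rewrite leq_addl.
  apply: (@le_trans _ _ (\sum_(x <- basilica_ball N) expR (- length_potential x))).
    by apply: ler_sum_uniq => // x; exact: expR_ge0.
  by apply: le_trans (sum_ball N) _; rewrite gerBl exprn_ge0 // invr_ge0.
Qed.

(** Each lift multiplies the growth by r < 1. *)
Lemma small_potential (e : R) : 0 < e -> exists Phi : treeAut -> R, potential e Phi.
Proof.
move=> e0.
have iterate k : exists Phi : treeAut -> R, potential (sqrt_half R ^+ k * 4) Phi.
  elim: k => [|k [Phi PhiP]].
    by exists length_potential; rewrite expr0 mul1r; exact: length_potentialP.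
  by exists (lift_potential Phi); rewrite exprS -mulrA; exact: potential_lift.
pose k := Num.bound (4 / e).
have [Phi [drift lip sumK]] := iterate (2 * k)%N.
exists Phi; split=> // g; apply: le_trans (drift g) _; rewrite lerD2l.
rewrite exprM expr2 sqrt_half_sqr exprVn -ler_pdivlMl ?invr_gt0 ?exprn_gt0 // invrK.
rewrite -ler_pdivrMr //.
have /ltW/le_trans := archi_boundP (ltW (divr_gt0 (ltr0Sn R 3) e0)); apply.
by rewrite -natrX ler_nat ltnW // ltn_expl.
Qed.

Lemma in_basilica_a : `[< G a >]. Proof. by apply/asboolP; exact: Ga. Qed.
Lemma in_basilica_b : `[< G b >]. Proof. by apply/asboolP; exact: Gb. Qed.
Definition basilica_a : basilica := GenGroup in_basilica_a.
Definition basilica_b : basilica := GenGroup in_basilica_b.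

(** The walk stays put with probability 1/2, so that its law is compared with
    itself and not only with its translates. *)
Definition lazy_letter (i : 'I_5) : basilica :=
  nth 1%g [:: 1; basilica_a; basilica_a^-1; basilica_b; basilica_b^-1]%g i.

Definition lazy_weight (i : 'I_5) : R :=
  nth 0 [:: 2^-1; weight_a R / 2; weight_a R / 2; weight_b R / 2; weight_b R / 2] i.

Lemma lazy_letter_gen : gen_set (range lazy_letter) = setT.
Proof.
apply/seteqP; split=> // x _.
pose K := [set g | exists2 y : basilica, val y = g & gen_set (range lazy_letter) y].
suff : K (val x) by move=> [y /val_inj ->].
apply: (@gen_set_ind _ [set a; b] K); last exact: (asboolW (gen_valP x)).
  split.
  - by exists 1%g; [exact: val1|exact: gen_set1].
  - move=> _ _ [y <- Ky] [z <- Kz]; exists (y * z)%g; first exact: valM.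
    exact: gen_setM.
  - by move=> _ [y <- Ky]; exists y^-1%g; [exact: gmulfV|exact: gen_setV].
move=> _ [->|->].
- exists basilica_a => //; apply: gen_set_gen.
  by exists (Ordinal (isT : (1 < 5)%N)).
- exists basilica_b => //; apply: gen_set_gen.
  by exists (Ordinal (isT : (3 < 5)%N)).
Qed.

Theorem basilica_amenable : amenable R basilica.
Proof.
have [r_gt r_lt] := sqrt_half_bounds R.
have a0 : 0 < weight_a R by rewrite subr_gt0.
have b0 : 0 < weight_b R by rewrite subr_gt0.
apply: (@amenable_of_slow_potentials R basilica _ lazy_weight lazy_letter) _ ord0 _ _.
- by case=> -[|[|[|[|[|//]]]]] lt; rewrite /lazy_weight /= ?divr_gt0 ?invr_gt0.
- by rewrite !big_ord_recl big_ord0 /lazy_weight /= /weight_a /weight_b; lra.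
- move=> e e0; have [Phi [drift _ [K sumK]]] := small_potential e0.
  exists (fun x => Phi (val x)), K; split=> [g|A].
    rewrite !big_ord_recl big_ord0 /lazy_weight /lazy_letter /= !mulg1.
    have := drift (val g); rewrite /average; lra.
  rewrite -(big_map val predT (fun x => expR (- Phi x))).
  pose B := [fset val x | x in A]%fset.
  rewrite (perm_big B) /=; last first.
    apply: uniq_perm; rewrite ?fset_uniq ?map_inj_uniq ?fset_uniq //.
      exact: val_inj.
    by move=> y; apply/mapP/imfsetP => -[x xA ->]; exists x.
  by apply: sumK => _ /imfsetP[x _ ->]; exact: (asboolW (gen_valP x)).
- by [].
- exact: lazy_letter_gen.
Qed.

End Amenability.

Theorem mainTheorem3 (R : realType) :
  amenable R basilica /\ SG R <> AG R.
Proof.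
split; first exact: basilica_amenable.
move=> SG_AG; apply: (@basilica_not_SG R).
by rewrite SG_AG; exact: basilica_amenable.
Qed.
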